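(* Let $\lambda\ge0$, $K\ge0$. When $0<h\le1/\lambda$ (any $h>0$ if $\lambda=0$), the quasi-compact difference scheme $${}_{R}\mathcal{B}U_i^{n+1}-K\tau\left(\frac1{h^\alpha}\sum_{k=0}^{M-i+1}w_k^{(\alpha,\lambda)}U_{i+k-1}^{n+1}-\frac{\alpha\lambda^{\alpha-1}}{2h}\left(e^{\lambda h}U_{i-1}^{n+1}-e^{-\lambda h}U_{i+1}^{n+1}\right)+\lambda^\alpha(\alpha-1)\,{}_{R}\mathcal{B}U_i^{n+1}\right)={}_{R}\mathcal{B}U_i^n+\tau\,{}_{R}\mathcal{B}f_i^{n+1},\quad 1\le i\le M-1,\ 0\le n\le N-1,$$ is stable for all $1<\alpha<2$.
   Context: The scheme discretizes $\partial_tu=K\,{}_xD_b^{\alpha,\lambda}u+f$ on $(a,b)\times(0,T]$ with $u(x,0)=u_0(x)$, $u(a,t)=u_a(t)$, $u(b,t)=0$, on the grid $x_i=a+ih$, $h=(b-a)/M$, $t_n=n\tau$, $\tau=T/N$ ($M,N$ positive integers), with $f_i^n=f(x_i,t_n)$ and boundary values $U_0^n=u_a(t_n)$, $U_M^n=0$. Here ${}_xD_b^{\alpha,\lambda}u(x)=\frac{e^{\lambda x}}{\Gamma(2-\alpha)}\frac{d^2}{dx^2}\int_x^b(s-x)^{1-\alpha}e^{-\lambda s}u(s)ds-\lambda^\alpha u(x)+\alpha\lambda^{\alpha-1}u'(x)$. The compact operator is ${}_{R}\mathcal{B}V_i=\frac16e^{\lambda h}V_{i-1}+\frac23V_i+\frac16e^{-\lambda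 h}V_{i+1}$. The weights: let $g_k^{(\alpha)}=\frac{\Gamma(k-\alpha)}{\Gamma(-\alpha)\Gamma(k+1)}$, $\mu_{-1}=\frac1{24}(4-7\alpha+3\alpha^2)$, $\mu_0=\frac1{12}(8+\alpha-3\alpha^2)$, $\mu_1=\frac1{24}(4+5\alpha+3\alpha^2)$. Then $w_0^{(\alpha,\lambda)}=\mu_1g_0^{(\alpha)}e^{\lambda h}$, $w_1^{(\alpha,\lambda)}=\mu_1g_1^{(\alpha)}+\mu_0g_0^{(\alpha)}$, and $w_k^{(\alpha,\lambda)}=(\mu_1g_k^{(\alpha)}+\mu_0g_{k-1}^{(\alpha)}+\mu_{-1}g_{k-2}^{(\alpha)})e^{(1-k)\lambda h}$ for $k\ge2$. Stability: the scheme is stable if there is a constant $C$, independent of $n,\tau,h$ (it may depend on $\alpha,\lambda,K,a,b,T$), such that for any two solutions $\tilde U,U$ of the scheme with the same $f$ and the same boundary values but possibly different initial values, the difference $\varepsilon^n=\tilde U^n-U^n$ (which vanishes at $i=0$ and $i=M$) satisfies $\|\varepsilon^n\|\le C\|\varepsilon^0\|$ for all $0\le n\le N$, where $\|v\|^2=h\sum_{i=1}^{M-1}v_i^2$. *)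

(* Defs.v *)
From mathcomp Require Import all_boot all_order all_algebra.
From mathcomp Require Import all_classical all_reals all_analysis.

Set Implicit Arguments.
Unset Strict Implicit.
Unset Printing Implicit Defensive.

Import Order.TTheory GRing.Theory Num.Theory.
Import numFieldNormedType.Exports.

Local Open Scope classical_set_scope.
Local Open Scope ring_scope.

Section Gamma.
Context {R : realType}.

Definition Gamma_integral (x : R) : R :=
  \int[@lebesgue_measure R]_(t in `]0, +oo[) (t `^ (x - 1) * expR (- t)).

(* The least n with 0 < x + n. *)
Definition Gamma_shift (x : R) : nat :=
  if 0 < x then 0%N else (Num.truncn (- x)).+1.

(* Euler's integral for 0 < x, continued to negative non-integers by
   Gamma x = Gamma (x + n) / (x (x + 1) ... (x + n - 1)); the value at a pole
   is 0, since division by 0 yields 0. *)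
Definition Gamma (x : R) : R :=
  Gamma_integral (x + (Gamma_shift x)%:R)
    / \prod_(j < Gamma_shift x) (x + j%:R).

End Gamma.

Section Weights.
Context {R : realType}.
Variables (alpha lambda h : R).

Definition g (k : nat) : R :=
  Gamma (k%:R - alpha) / (Gamma (- alpha) * Gamma (k%:R + 1)).

(* mu_{-1} *)
Definition mu_m1 : R := 1 / 24 * (4 - 7 * alpha + 3 * alpha ^+ 2).
Definition mu_0 : R := 1 / 12 * (8 + alpha - 3 * alpha ^+ 2).
Definition mu_1 : R := 1 / 24 * (4 + 5 * alpha + 3 * alpha ^+ 2).

Definition w (k : nat) : R :=
  match k with
  | 0 => mu_1 * g 0 * expR (lambda * h)
  | 1 => mu_1 * g 1 + mu_0 * g 0
  | j.+2 => (mu_1 * g j.+2 + mu_0 * g j.+1 + mu_m1 * g j)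
              * expR ((1 - k%:R) * lambda * h)
  end.

End Weights.

Section Scheme.
Context {R : realType}.

(* A grid function on {0, ..., M} is an element of nat -> R, of which only the
   values at indices at most M are ever used. *)
Definition compactB (lambda h : R) (V : nat -> R) (i : nat) : R :=
  1 / 6 * expR (lambda * h) * V i.-1 + 2 / 3 * V i
    + 1 / 6 * expR (- (lambda * h)) * V i.+1.

(* The discrete spatial operator multiplying K tau. As i >= 1, the index
   i + k - 1 does not truncate. For lambda = 0 and 1 < alpha < 2, the powers
   of lambda below are 0. *)
Definition spatial_op (alpha lambda h : R) (M : nat) (V : nat -> R) (i : nat)
    : R :=
  1 / h `^ alpha
      * (\sum_(0 <= k < (M - i + 1).+1) w alpha lambda h k * V (i + k - 1)%N)
  - alpha * lambda `^ (alpha - 1) / (2 * h)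
      * (expR (lambda * h) * V i.-1 - expR (- (lambda * h)) * V i.+1)
  + lambda `^ alpha * (alpha - 1) * compactB lambda h V i.

(* U n i stands for U_i^n. At n = 0 the end nodes carry the boundary values,
   so the initial condition is imposed at interior nodes only. *)
Definition scheme_solution (alpha lambda K a b T : R) (M N : nat)
    (f : R -> R -> R) (u_a u0 : R -> R) (U : nat -> nat -> R) : Prop :=
  let h := (b - a) / M%:R in
  let tau := T / N%:R in
  let x i := a + i%:R * h in
  let t n := n%:R * tau in
  [/\ forall i, (1 <= i <= M - 1)%N -> U 0 i = u0 (x i),
      forall n, (n <= N)%N -> U n 0 = u_a (t n),
      forall n, (n <= N)%N -> U n M = 0
    & forall n i, (n <= N - 1)%N -> (1 <= i <= M - 1)%N ->
        compactB lambda h (U n.+1) i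
          - K * tau * spatial_op alpha lambda h M (U n.+1) i
        = compactB lambda h (U n) i
          + tau * compactB lambda h (fun j => f (x j) (t n.+1)) i].

Definition grid_norm (h : R) (M : nat) (v : nat -> R) : R :=
  Num.sqrt (h * \sum_(1 <= i < M) v i ^+ 2).

(* Stability of the scheme over all meshes whose step h satisfies meshP. The
   constant C is chosen before the mesh and before the data f, u_a. *)
Definition stable (alpha lambda K a b T : R) (meshP : R -> Prop) : Prop :=
  exists C : R, forall M N : nat, (0 < M)%N -> (0 < N)%N ->
    let h := (b - a) / M%:R in
    meshP h ->
    forall (f : R -> R -> R) (u_a u0 u0' : R -> R) (U U' : nat -> nat -> R),
      scheme_solution alpha lambda K a b T M N f u_a u0 U ->
      scheme_solution alpha lambda K a b T M N f u_a u0' U' ->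
      let eps n i := U' n i - U n i in
      forall n, (n <= N)%N ->
        grid_norm h M (eps n) <= C * grid_norm h M (eps 0%N).

End Scheme.

(* Main.v *)
Require Import Defs.
From mathcomp Require Import all_boot all_order all_algebra.
From mathcomp Require Import all_classical all_reals all_analysis.
From mathcomp Require Import measurable_realfun zify ring lra.

(* The core is that sum_i v_i (A v)_i <= 0 for the spatial operator A. As a
   combination of the autocorrelations T_k = sum_i v_i v_(i+k), this form has
   nonnegative coefficients for k >= 3, and those of T_1 and T_2 are controlled
   by T_0 - T_2 <= 4 (T_0 - T_1); so it is at most T_0 times the sum of its
   coefficients. The Gruenwald generating function (1 - y)^alpha at
   y = e^(-lambda h) bounds that sum by the symbol of A at frequency 0, whose
   sign follows from Taylor bounds of the exponential and a polynomial
   inequality on the unit square.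

   The operator B is not symmetric, so the energy method is applied twice. When
   tau is small, the tilt v_i = e^(-lambda h i) eps_i makes B symmetric and A
   untempered, up to a skew term and a multiple of B that costs a factor
   1 + O(tau) per step. When tau is bounded below there are boundedly many steps,
   and dissipativity of A with coercivity of B bounds each of them. *)

Import Order.TTheory GRing.Theory Num.Theory.
Import numFieldNormedType.Exports.
Local Open Scope ring_scope.

(** * Euler's integral, its recurrence, and Gamma on (-2, 0) *)

Section GammaFunction.
Local Open Scope classical_set_scope.
Context {R : realType}.
Notation mu := (@lebesgue_measure R).

(** The compact intervals [[lo n], [hi n]] increase to the open half-line; the offset 2 keeps them
    nondegenerate at n = 0. *)
Let lo (n : nat) : R := n.+2%:R^-1.
Let hi (n : nat) : R := n.+2%:R.

Let lo_gt0 n : 0 < lo n. Proof. by rewrite invr_gt0. Qed.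

Let lo_lt_hi n : lo n < hi n.
Proof. by rewrite (@lt_trans _ _ 1) // ?invf_lt1 ?ltr1n. Qed.

Definition gamma_integrand (x t : R) : R := t `^ x * expR (- t).

Let cvg_lo : lo n @[n --> \oo] --> (0 : R).
Proof. by have := @cvg_harmonic R; rewrite -cvg_shiftS. Qed.

(** With x <= m, the Taylor term of order m + 1 of the exponential bounds the expression by (m + 1)!
    / (n + 2). *)
Let cvg_hi_powR_expRN (x : R) : hi n `^ x * expR (- hi n) @[n --> \oo] --> (0 : R).
Proof.
have [m xm] : exists m : nat, x <= m%:R.
  by exists (Num.truncn x).+1; rewrite ltW // truncnS_gt.
apply: (@squeeze_cvgr _ _ _ _ (fun=> 0) (fun n => m.+1`!%:R * lo n)); last 2 first.
- exact: cvg_cst.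
- by rewrite -[X in _ --> X](mulr0 m.+1`!%:R); apply: cvgMr.
apply: nearW => n; rewrite mulr_ge0 ?powR_ge0 ?expR_ge0 //=.
have hi1 : 1 <= hi n by rewrite ler1n.
have hi0 : 0 < hi n by exact: lt_le_trans hi1.
apply: (@le_trans _ _ (hi n ^+ m * expR (- hi n))).
  by rewrite ler_pM2r ?expR_gt0 // -powR_mulrn ?(ltW hi0) // ler_powR.
have := @expR_ge1Dxn R (hi n) m (ltW hi0).
rewrite expRN => e1; rewrite ler_pdivrMr ?expR_gt0 //.
have F0 : 0 < m.+1`!%:R :> R by rewrite ltr0n fact_gt0.
have Fl0 : 0 <= m.+1`!%:R * lo n by rewrite mulr_ge0 // ltW.
have e2 : hi n ^+ m.+1 / m.+1`!%:R <= expR (hi n) by apply: le_trans e1; rewrite lerDr.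
apply: le_trans (ler_wpM2l Fl0 e2).
have -> : lo n = (hi n)^-1 by [].
rewrite (_ : _ * (_ / _) = hi n ^+ m) // exprS; field.
by rewrite (gt_eqF F0) gt_eqF.
Qed.

(** Integration by parts with the antiderivative -e^-t. The interval stays away from 0, so every
    real x is allowed. *)
Let parts (x : R) n :
  (\int[mu]_(t in `[lo n, hi n]) (gamma_integrand x t)%:E
  = (lo n `^ x * expR (- lo n) - hi n `^ x * expR (- hi n))%:E
    + x%:E * \int[mu]_(t in `[lo n, hi n]) (gamma_integrand (x - 1) t)%:E)%E.
Proof.
have dx (t : R) : 0 < t -> is_derive t 1 (fun u : R => u `^ x) (x * t `^ (x - 1)).
  exact: is_derive1_powR.
have dG (t : R) : is_derive t 1 (- (expR \o -%R)) (expR (- t)).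
  have -> : expR (- t) = - (expR (- t) * -1) by rewrite mulrN1 opprK.
  by apply: is_deriveN; apply: is_derive1_comp.
have cG (t : R) : {for t, continuous (- (expR \o -%R) : R -> R)}.
  by apply: differentiable_continuous; apply/derivable1_diffP; case: (dG t).
have cE (t : R) : {for t, continuous (fun u : R => expR (- u))}.
  by apply: differentiable_continuous; apply/derivable1_diffP; apply: ex_derive;
    apply: is_derive1_comp.
have cx y (t : R) : 0 < t -> {for t, continuous (fun u : R => u `^ y)}.
  move=> t0; apply: differentiable_continuous; apply/derivable1_diffP.
  by case: (@is_derive1_powR R y t t0).
have c0 t : t \in `[lo n, hi n]%R -> 0 < t.
  by rewrite in_itv /= => /andP[/(lt_le_trans (lo_gt0 n))].
have d0 t : t \in `]lo n, hi n[%R -> 0 < t.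
  by rewrite in_itv /= => /andP[/(lt_trans (lo_gt0 n))].
have hi0 : 0 < hi n by exact: lt_trans (lo_lt_hi n).
have P1 : (\int[mu]_(t in `[lo n, hi n]) (t `^ x * expR (- t))%:E
  = (hi n `^ x * - expR (- hi n) - lo n `^ x * - expR (- lo n))%:E
    - \int[mu]_(t in `[lo n, hi n]) ((x * t `^ (x - 1)) * - expR (- t))%:E)%E.
  apply: (@integration_by_parts R (fun u : R => u `^ x) (- (expR \o -%R))
    (fun t => x * t `^ (x - 1)) (expR \o -%R)) => //.
  - apply: continuous_in_subspaceT => t; rewrite inE /= => /c0 t0.
    by apply: cvgMr; exact: cx.
  - split=> [t /d0 t0| |].
    + by case: (dx _ t0).
    + by apply: cvg_at_right_filter; exact: cx.
    + by apply: cvg_at_left_filter; exact: cx.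
  - by move=> t /d0 t0; rewrite derive1E (@derive_val _ _ _ _ _ _ _ (dx _ t0)).
  - apply: continuous_in_subspaceT => t _.
    exact: cE.
  - split=> [t _| |].
    + by case: (dG t).
    + by apply: cvg_at_right_filter; exact: cG.
    + by apply: cvg_at_left_filter; exact: cG.
  - by move=> t _; rewrite derive1E (@derive_val _ _ _ _ _ _ _ (dG t)).
rewrite /gamma_integrand P1; congr (_ + _)%E.
  by rewrite !mulrN opprK addrC.
have int y : mu.-integrable `[lo n, hi n] (fun t => (t `^ y * expR (- t))%:E).
  apply: continuous_compact_integrable; first exact: segment_compact.
  apply: continuous_in_subspaceT => t; rewrite inE /= => /c0 t0.
  apply: cvgM; first exact: cx.
  exact: cE.
rewrite [X in (- X)%E](_ : _ =
    (- x)%:E * \int[mu]_(t in `[lo n, hi n]) (t `^ (x - 1) * expR (- t))%:E)%E.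
  by rewrite EFinN mulNe oppeK.
rewrite -integralZl //; apply: eq_integral => t _.
by rewrite -EFinM mulrN mulNr mulrA.
Qed.

(** At x = 0 the lower boundary term tends to 1 instead of 0; this produces the value in
    [gamma_ereal_0]. *)
Let cvg_lo_hi (x : R) : 0 <= x ->
  lo n `^ x * expR (- lo n) - hi n `^ x * expR (- hi n) @[n --> \oo] --> ((x == 0)%:R : R).
Proof.
move=> x0; rewrite -[X in _ --> X]subr0; apply: cvgB; last exact: cvg_hi_powR_expRN.
have cE : (fun u : R => expR (- u)) u @[u --> (0 : R)] --> (1 : R).
  rewrite -[X in _ --> X]expR0 -[X in expR X]oppr0.
  apply: (@differentiable_continuous _ _ _ _ (fun u : R => expR (- u))).
  by apply/derivable1_diffP; apply: ex_derive; apply: is_derive1_comp.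
rewrite -[X in _ --> X]mulr1; apply: cvgM; last exact: cvg_comp cvg_lo cE.
have [->|xn0] := eqVneq x 0.
  by under eq_fun do rewrite powRr0; exact: cvg_cst.
have xp : 0 < x by rewrite lt_neqAle eq_sym xn0.
by have /cvg_at_rightP := powR_cvg0 xp; apply; split.
Qed.

(** Gamma at x + 1, as the exponent is x and not x - 1. Extended real values let the recurrence be
    proved before finiteness. *)
Definition gamma_ereal (x : R) : \bar R :=
  (\int[mu]_(t in `]0%R, +oo[) (gamma_integrand x t)%:E)%E.

Lemma measurable_gamma_integrand (x : R) (D : set (measurableTypeR R)) :
  measurable_fun D (fun t => (gamma_integrand x t)%:E).
Proof.
apply/measurable_EFinP; apply: measurable_funM.
  by apply: measurable_funTS; exact: measurable_powR.
by apply: measurableT_comp => //; apply: measurable_funTS.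
Qed.

Lemma gamma_integrand_ge0 (x t : R) : 0 <= gamma_integrand x t.
Proof. by rewrite mulr_ge0 ?powR_ge0 ?expR_ge0. Qed.

Let cvg_gamma (x : R) :
  (\int[mu]_(t in `[lo n, hi n]) (gamma_integrand x t)%:E)%E @[n --> \oo] --> gamma_ereal x.
Proof.
have -> : gamma_ereal x = (\int[mu]_(t in \bigcup_n `[lo n, hi n]) (gamma_integrand x t)%:E)%E.
  congr (integral _ _ _); apply/seteqP; split=> [t|t [n _]] /=.
    rewrite in_itv /= andbT => t0.
    have [n tn] : exists n : nat, Num.max t t^-1 <= n%:R.
      by exists (Num.truncn (Num.max t t^-1)).+1; rewrite ltW // truncnS_gt.
    exists n => //=; rewrite in_itv /=; move: tn; rewrite ge_max => /andP[t1 t2].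
    have nn : (n%:R : R) <= n.+2%:R by rewrite ler_nat leqW.
    rewrite (le_trans t1 nn) andbT -[t]invrK lef_pV2 ?posrE ?invr_gt0 //.
    exact: le_trans t2 nn.
  by rewrite !in_itv /= andbT => /andP[/(lt_le_trans (lo_gt0 n))].
apply: ge0_nondecreasing_set_cvg_integral => //.
- apply/nondecreasing_seqP => n; rewrite subsetEset => t /=; rewrite !in_itv /=.
  move=> /andP[t1 t2]; apply/andP; split; last by rewrite (le_trans t2) // ler_nat.
  by apply: le_trans t1; rewrite lef_pV2 ?posrE // ler_nat.
- by move=> n; exact: measurable_gamma_integrand.
- by move=> n t _; rewrite lee_fin gamma_integrand_ge0.
Qed.

Lemma gamma_ereal_rec (x : R) : 0 < x -> gamma_ereal x = (x%:E * gamma_ereal (x - 1))%E.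
Proof.
move=> x0; have := cvg_gamma x; under eq_fun do rewrite parts.
move=> /cvg_lim <- //; apply/cvg_lim => //.
rewrite -[X in _ --> X]add0e; apply: cvgeD => //; last by apply: cvgeZl.
by apply: cvg_EFin; [exact: nearW|have := cvg_lo_hi _ (ltW x0); rewrite gt_eqF].
Qed.

Lemma gamma_ereal_0 : gamma_ereal 0 = 1%E.
Proof.
have := cvg_gamma 0; under eq_fun do rewrite parts mul0e adde0.
move=> /cvg_lim <- //; apply/cvg_lim => //.
by apply: cvg_EFin; [exact: nearW|have := cvg_lo_hi _ (lexx 0); rewrite eqxx].
Qed.

Lemma gamma_ereal_ge0 (x : R) : (0 <= gamma_ereal x)%E.
Proof. by apply: integral_ge0 => t _; rewrite lee_fin gamma_integrand_ge0. Qed.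

(** Below, the integrand is at least e^-2 on [1, 2]; above, t^y <= 1 + t gives Gamma(1) + Gamma(2) =
    2. Finiteness matters because [fine] sends an infinite integral to 0, which would spoil the
    division in [g0]. *)
Lemma gamma_ereal_bounds (y : R) : 0 <= y <= 1 -> ((expR (-2))%:E <= gamma_ereal y <= 2%:E)%E.
Proof.
move=> /andP[y0 y1]; apply/andP; split.
  apply: (@le_trans _ _ (\int[mu]_(t in `[1%R, 2%R]) (gamma_integrand y t)%:E)%E).
    apply: (@le_trans _ _ (\int[mu]_(t in `[1%R, 2%R]) (cst (expR (-2))%:E) t)%E).
      by rewrite integral_cst //= lebesgue_measure_itv /= lte_fin ltr1n -EFinD -EFinM lee_fin; lra.
    apply: ge0_le_integral => //=.
    - exact: measurable_gamma_integrand.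
    - move=> t; rewrite /= in_itv /= => /andP[t1 t2]; rewrite lee_fin.
      rewrite -[expR (-2)]mul1r ler_pM ?expR_ge0 //.
        by rewrite -[leLHS](powRr0 t) ler_powR.
      by rewrite ler_expR lerN2.
  apply: ge0_subset_integral => //=.
  - exact: measurable_gamma_integrand.
  - by move=> t _; rewrite lee_fin gamma_integrand_ge0.
  - by move=> t /=; rewrite !in_itv /= andbT => /andP[t1 _]; exact: lt_le_trans t1.
have -> : (2%:E = gamma_ereal 0 + gamma_ereal 1 :> \bar R)%E.
  by rewrite (gamma_ereal_rec _ ltr01) subrr mul1e gamma_ereal_0 -EFinD.
rewrite -ge0_integralD //=; first last.
- exact: measurable_gamma_integrand.
- by move=> t _; rewrite lee_fin gamma_integrand_ge0.
- exact: measurable_gamma_integrand.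
- by move=> t _; rewrite lee_fin gamma_integrand_ge0.
apply: ge0_le_integral => //=.
- by move=> t _; rewrite lee_fin gamma_integrand_ge0.
- exact: measurable_gamma_integrand.
- by apply: emeasurable_funD; exact: measurable_gamma_integrand.
- move=> t; rewrite /= in_itv /= andbT => t0.
  rewrite -EFinD lee_fin -mulrDl ler_pM2r ?expR_gt0 // powRr0 powRr1 ?(ltW t0) //.
  have [t1|t1] := leP t 1.
    rewrite ler_wpDr ?(ltW t0) // -[leRHS](congr1 (fun f => f y) (@powR1 R)).
    by rewrite ge0_ler_powR ?nnegrE ?(ltW t0).
  by rewrite ler_wpDl // -[leRHS](@powRr1 R) ?(ltW t0) // ler_powR // ltW.
Qed.

Lemma Gamma_integralE (x : R) : Gamma_integral x = fine (gamma_ereal (x - 1)).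
Proof. by []. Qed.

Lemma Gamma_integral_rec (x : R) : 0 < x -> Gamma_integral (x + 1) = x * Gamma_integral x.
Proof.
move=> x0; rewrite !Gamma_integralE addrK (gamma_ereal_rec _ x0).
have := gamma_ereal_ge0 (x - 1); case: (gamma_ereal (x - 1)) => [r _|_|//].
  by rewrite -EFinM.
(* If the integral is infinite, [fine] makes both sides 0. *)
by rewrite mulry gtr0_sg // mul1e mulr0.
Qed.

Lemma Gamma_integral_1 : Gamma_integral 1 = 1 :> R.
Proof. by rewrite Gamma_integralE subrr gamma_ereal_0. Qed.

Lemma Gamma_integral_neq0 (x : R) : 0 < x < 1 -> Gamma_integral x != 0.
Proof.
move=> /andP[x0 x1]; have : Gamma_integral (x + 1) != 0.
  rewrite Gamma_integralE addrK; have /gamma_ereal_bounds : 0 <= x <= 1 by rewrite !ltW.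
  case: (gamma_ereal x) => [r| |] //=; last by rewrite leye_eq andbF.
  by rewrite !lee_fin => /andP[/(lt_le_trans (expR_gt0 _))]; rewrite lt0r => /andP[].
by rewrite Gamma_integral_rec // mulf_eq0 negb_or => /andP[].
Qed.

(** For 1 < alpha < 2 the arguments k - alpha lie in (-2, -1), in (-1, 0) or above 0, so only the
    shifts 2, 1 and 0 occur. *)
Lemma Gamma_pos (x : R) : 0 < x -> Gamma x = Gamma_integral x.
Proof. by move=> x0; rewrite /Gamma /Gamma_shift x0 big_ord0 divr1 addr0. Qed.

Lemma Gamma_N1_0 (x : R) : -1 < x < 0 -> Gamma x = Gamma_integral (x + 1) / x.
Proof.
move=> /andP[x1 x0]; rewrite /Gamma /Gamma_shift ltNge (ltW x0) /=.
have -> : Num.truncn (- x) = 0%N.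
  by apply/eqP; rewrite -leqn0 truncn_le_nat ltrNl.
by rewrite big_ord1 addr0.
Qed.

Lemma Gamma_N2_N1 (x : R) : -2 < x < -1 -> Gamma x = Gamma_integral (x + 2) / (x * (x + 1)).
Proof.
move=> /andP[x2 x1]; have x0 : x < 0 by apply: lt_trans x1 _; rewrite ltrN10.
rewrite /Gamma /Gamma_shift ltNge (ltW x0) /=.
have -> : Num.truncn (- x) = 1%N.
  by apply/eqP; rewrite eqn_leq truncn_le_nat truncn_gt0 ltrNl x2 lerNr ltW.
by rewrite !big_ord_recr big_ord0 /= mul1r addr0.
Qed.

End GammaFunction.

(** * Recurrence of the Gruenwald weights *)

Section GrunwaldWeights.
Variables (R : realType) (alpha : R).
Hypothesis halpha : 1 < alpha < 2.

Lemma g0 : g alpha 0 = 1.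
Proof.
have /andP[a1 a2] := halpha.
rewrite /g sub0r add0r (Gamma_pos 1) // Gamma_integral_1 mulr1 divff //.
rewrite Gamma_N2_N1; last by rewrite ltrN2 a2 ltrN2.
rewrite mulf_neq0 // ?invr_neq0 ?mulf_neq0 ?Gamma_integral_neq0 //.
- by apply/andP; split; lra.
- by rewrite lt_eqF //; lra.
- by rewrite lt_eqF //; lra.
Qed.

Lemma gS k : g alpha k.+1 = g alpha k * ((k%:R - alpha) / k.+1%:R).
Proof.
have /andP[a1 a2] := halpha.
have fact_step : Gamma (k.+1%:R + 1 : R) = k.+1%:R * Gamma (k%:R + 1).
  have k0 : 0 < k.+1%:R :> R by rewrite ltr0n.
  by rewrite [k%:R + 1]natr1 !Gamma_pos ?Gamma_integral_rec ?addr_gt0.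
have gamma_step : Gamma (k.+1%:R - alpha) = (k%:R - alpha) * Gamma (k%:R - alpha).
  (* For k = 0 and k = 1 the argument passes from one strip of the continuation to the next; from k
     = 2 on it is positive. *)
  case: k fact_step => [|[|k]] _.
  - rewrite sub0r Gamma_N1_0; last by apply/andP; split; lra.
    rewrite Gamma_N2_N1; last by apply/andP; split; lra.
    rewrite (_ : 1 - alpha + 1 = - alpha + 2); last by ring.
    by field; rewrite lt_eqF ?gt_eqF /=; lra.
  - rewrite Gamma_pos; last by lra.
    rewrite Gamma_N1_0; last by apply/andP; split; lra.
    rewrite (_ : 2 - alpha = 1 - alpha + 1); last by ring.
    by rewrite mulrC mulfVK // lt_eqF //; lra.
  - have k2 : 2 <= k.+2%:R :> R by rewrite ler_nat.
    rewrite !Gamma_pos -?natr1; try by lra.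
    by rewrite addrAC Gamma_integral_rec //; lra.
by rewrite /g gamma_step fact_step !invfM; ring.
Qed.

End GrunwaldWeights.

(** * Taylor bounds for the exponential *)

Lemma is_derive_nneg_le (R : realType) (f df : R -> R) :
  (forall t : R, 0 <= t -> is_derive t 1 f (df t)) -> (forall t : R, 0 <= t -> 0 <= df t) ->
  forall z : R, 0 <= z -> f 0 <= f z.
Proof.
move=> fdf df0 z z0.
have d0 (t : R) : 0 <= t -> derivable f t 1 by move=> /fdf [].
apply: (@ger0_derive1_ndecry _ f 0) => // [t|t|].
- by rewrite in_itv /= andbT => /ltW/d0.
- rewrite in_itv /= andbT => /ltW t0.
  by rewrite derive1E (@derive_val _ _ _ _ _ _ _ (fdf t t0)) df0.
- apply: derivable_within_continuous => t; rewrite in_itv /= andbT; exact: d0.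
Qed.

(** Induction on n: the signed remainder of order n + 1 vanishes at 0 and has the signed remainder
    of order n as its derivative. *)
Lemma expRN_taylor_sign (R : realType) n (z : R) : 0 <= z ->
  0 <= (-1) ^+ n * (expR (- z) - \sum_(k < n) (- z) ^+ k / k`!%:R).
Proof.
elim: n z => [|n IHn] z z0; first by rewrite big_ord0 expr0 mul1r subr0 expR_ge0.
pose f (t : R) := (-1) ^+ n.+1 * (expR (- t) - \sum_(k < n.+1) (- t) ^+ k / k`!%:R).
have df (t : R) : is_derive t 1 f
    ((-1) ^+ n * (expR (- t) - \sum_(k < n) (- t) ^+ k / k`!%:R)).
  pose P : {poly R} := \sum_(k < n.+1) ((-1) ^+ k / k`!%:R) *: 'X^k.
  have -> : f = (-1) ^+ n.+1 *: ((expR \o -%R) - horner P).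
    apply/funext => u; rewrite /f /P /= !fctE /= horner_sum; congr (_ * (_ - _)).
    by apply: eq_bigr => k _; rewrite hornerZ hornerXn (exprNn u) mulrAC.
  have -> : (-1) ^+ n * (expR (- t) - \sum_(k < n) (- t) ^+ k / k`!%:R)
      = (-1) ^+ n.+1 *: (expR (- t) * -1 - P^`().[t]).
    rewrite /GRing.scale /= exprS mulN1r mulNr -mulrN opprB mulrN1 opprK.
    rewrite [RHS]mulrC [LHS]mulrC addrC. congr ((_ + _) * _).
    rewrite /P big_ord_recl /= derivD derivZ derivXn mulr0n scaler0 add0r.
    rewrite -sumrN raddf_sum /= horner_sum; apply: eq_bigr => k _.
    rewrite derivZ derivXn hornerZ hornerMn hornerXn /bump /= add1n (exprNn t).
    rewrite exprS factS natrM invfM -mulr_natl.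
    have k1 : (k.+1%:R : R) != 0 by rewrite pnatr_eq0.
    have kf : (k`!%:R : R) != 0 by rewrite pnatr_eq0 -lt0n fact_gt0.
    by field; rewrite kf nat1r k1.
  by apply: is_deriveZ; apply: is_deriveB; apply: is_derive1_comp.
have f0 : f 0 = 0.
  rewrite /f oppr0 expR0 big_ord_recl /= expr0 fact0 divr1 big1 ?addr0 ?subrr ?mulr0 //.
  by move=> k _; rewrite exprS !mul0r.
suff : f 0 <= f z by rewrite f0.
by apply: (is_derive_nneg_le _ _ _ (fun t _ => df t)) => // t; exact: IHn.
Qed.

Section ExpBounds.
Variables (R : realType) (z : R).
Hypothesis z01 : 0 <= z <= 1.

Lemma expRN_ge_taylor5 : 1 - z + z ^+ 2 / 2 - z ^+ 3 / 6 + z ^+ 4 / 24 - z ^+ 5 / 120 <= expR (- z).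
Proof.
have /andP[z0 _] := z01.
have := expRN_taylor_sign _ 6 _ z0.
rewrite !big_ord_recr big_ord0 /= !factS fact0 !exprS expr0; lra.
Qed.

Lemma expRN_ge_taylor3 : 1 - z + z ^+ 2 / 2 - z ^+ 3 / 6 <= expR (- z).
Proof.
have /andP[z0 _] := z01.
have := expRN_taylor_sign _ 4 _ z0.
rewrite !big_ord_recr big_ord0 /= !factS fact0 !exprS expr0; lra.
Qed.

(** The next term z^6 / 720 is absorbed through z^6 <= z^5, and 1/120 - 1/720 = 1/144. *)
Lemma expRN_le_taylor4 : expR (- z) <= 1 - z + z ^+ 2 / 2 - z ^+ 3 / 6 + z ^+ 4 / 24 - z ^+ 5 / 144.
Proof.
have /andP[z0 z1] := z01.
have := expRN_taylor_sign _ 7 _ z0.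
have : z ^+ 6 <= z ^+ 5 by rewrite exprS ler_piMl // exprn_ge0.
rewrite !big_ord_recr big_ord0 /= !factS fact0 !exprS expr0; lra.
Qed.

Lemma expRN_le_taylor2 : expR (- z) <= 1 - z + z ^+ 2 / 2.
Proof.
have /andP[z0 _] := z01.
have := expRN_taylor_sign _ 3 _ z0.
rewrite !big_ord_recr big_ord0 /= !factS fact0 !exprS expr0; lra.
Qed.

Lemma expRN2_ge :
  1 - 2 * z + 2 * z ^+ 2 - 4 / 3 * z ^+ 3 + 2 / 3 * z ^+ 4 - 4 / 15 * z ^+ 5 <= expR (- z) ^+ 2.
Proof.
have /andP[z0 z1] := z01.
have z20 : 0 <= 2 * z by lra.
have := expRN_taylor_sign _ 6 _ z20.
rewrite !big_ord_recr big_ord0 /= !factS fact0 !exprS expr0 !mulr1 -expRD.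
rewrite (_ : - (2 * z) = - z - z); last by ring.
lra.
Qed.

Lemma expRN2_le :
  expR (- z) ^+ 2 <= 1 - 2 * z + 2 * z ^+ 2 - 4 / 3 * z ^+ 3 + 2 / 3 * z ^+ 4 - 8 / 45 * z ^+ 5.
Proof.
have /andP[z0 z1] := z01.
have z20 : 0 <= 2 * z by lra.
have := expRN_taylor_sign _ 7 _ z20.
have : z ^+ 6 <= z ^+ 5 by rewrite exprS ler_piMl // exprn_ge0.
rewrite !big_ord_recr big_ord0 /= !factS fact0 !exprS expr0 !mulr1 -expRD.
rewrite (_ : - (2 * z) = - z - z); last by ring.
lra.
Qed.

(** After multiplication by e^-z it suffices that the truncated series times an upper Taylor
    polynomial of e^-z is at most 1. *)
Lemma expR_ge_taylor5 : 1 + z + z ^+ 2 / 2 + z ^+ 3 / 6 + z ^+ 4 / 24 + z ^+ 5 / 120 <= expR z.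
Proof.
have /andP[z0 z1] := z01.
have y6 : expR (- z) <= 1 - z + z ^+ 2 / 2 - z ^+ 3 / 6 + z ^+ 4 / 24 - z ^+ 5 / 120 + z ^+ 6 / 720.
  have := expRN_taylor_sign _ 7 _ z0.
  rewrite !big_ord_recr big_ord0 /= !factS fact0 !exprS expr0; lra.
have ez : expR z * expR (- z) = 1 by rewrite -expRD subrr expR0.
set T := (X in X <= _).
have T0 : 0 <= T.
  by rewrite /T; do ?apply: addr_ge0; rewrite ?divr_ge0 ?exprn_ge0.
rewrite -(ler_pM2r (expR_gt0 (- z))) ez.
apply: (le_trans (ler_wpM2l T0 y6)); rewrite /T.
have pz k : 0 <= z ^+ k by rewrite exprn_ge0.
have qz k : 0 <= z ^+ k * (1 - z) by rewrite mulr_ge0 // subr_ge0.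
move: (pz 6%N) (qz 6%N) (qz 7%N) (qz 8%N) (qz 9%N) (qz 10%N) (pz 11%N).
rewrite !exprS expr0; lra.
Qed.

(** The same device with a lower polynomial for e^-z; the coefficient 1/40, in place of 1/120, makes
    room for the tail of the series. *)
Lemma expR_le_taylor4 : expR z <= 1 + z + z ^+ 2 / 2 + z ^+ 3 / 6 + z ^+ 4 / 24 + z ^+ 5 / 40.
Proof.
have /andP[z0 z1] := z01.
have ez : expR z * expR (- z) = 1 by rewrite -expRD subrr expR0.
set T := (X in _ <= X).
have T0 : 0 <= T.
  by rewrite /T; do ?apply: addr_ge0; rewrite ?divr_ge0 ?exprn_ge0.
rewrite -(ler_pM2r (expR_gt0 (- z))) ez.
apply: le_trans (ler_wpM2l T0 expRN_ge_taylor5); rewrite /T.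
have pz k : 0 <= z ^+ k by rewrite exprn_ge0.
have qz k : 0 <= z ^+ k * (1 - z) by rewrite mulr_ge0 // subr_ge0.
move: (pz 5%N) (qz 5%N) (qz 6%N) (qz 7%N) (qz 8%N) (qz 9%N) (pz 10%N).
have : 0 <= z ^+ 5 * (1 - z) ^+ 2 by rewrite mulr_ge0 ?sqr_ge0.
rewrite !exprS expr0; lra.
Qed.

End ExpBounds.

(** * Polynomial inequalities on the unit square and the symbol at frequency 0 *)

Lemma bernstein_ge0 (R : numDomainType) (x z : R) i j k l : 0 <= x <= 1 -> 0 <= z <= 1 ->
  0 <= x ^+ i * (1 - x) ^+ j * (z ^+ k * (1 - z) ^+ l).
Proof. by move=> /andP[? ?] /andP[? ?]; rewrite !mulr_ge0 // exprn_ge0 // subr_ge0. Qed.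

(* [bernstein B i n k m] adds to the goal the positivity of the Bernstein
   products x^(i+a) (1-x)^(n-a) z^(k+b) (1-z)^(m-b), a <= n, b <= m, where B
   is an instance of bernstein_ge0; lra then finds a certificate. *)
Ltac bernstein_row B i n k m :=
  move: (B i n k m);
  lazymatch m with S ?m' => bernstein_row B i n (S k) m' | _ => idtac end.
Ltac bernstein_grid B i n k m :=
  bernstein_row B i n k m;
  lazymatch n with S ?n' => bernstein_grid B (S i) n' k m | _ => idtac end.
Ltac bernstein B i n k m :=
  bernstein_grid B i n k m; rewrite !exprS !expr0; lra.

Section SymbolPolynomial.
Variables (R : realFieldType) (x z : R).
Hypotheses (x01 : 0 <= x <= 1) (z01 : 0 <= z <= 1).

(** [p1], [p0] and [pm] are [mu_1], [mu_0] and [mu_m1] at alpha = 1 + x. *)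
Let p1 : R := (12 + 11 * x + 3 * x ^+ 2) / 24.
Let p0 : R := (6 - 5 * x - 3 * x ^+ 2) / 12.
Let pm : R := x * (3 * x - 1) / 24.

(* Bounds q^x for q = (1 - e^-z) / z: it dominates 1 - x t + (x t)^2 / 2, where
   t = z / 2 - z^2 / 24 - z^3 / 200 satisfies q <= e^-t. *)
Definition phi : R :=
  1 - x * (z / 2 - z ^+ 2 / 24 - z ^+ 3 / 200) + x ^+ 2 * (z ^+ 2 / 8 - z ^+ 3 / 48).

(* Coefficients of e^z, e^-z and e^-2z in the inequality [symbol_poly_le];
   they vanish at x = 0. *)
Let a1 : R := (1 + x) / 2 - x * z / 6 - p1 * phi.
Let a2 : R := - (1 + x) / 2 - x * z / 6 + (p0 - pm) * phi.
Let a3 : R := pm * phi.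

Let B i j k l := bernstein_ge0 _ x z i j k l x01 z01.

Let a1_norm : `|a1| <= x / 6.
Proof.
by rewrite ler_norml /a1 /p1 /phi; apply/andP; split; bernstein B 1%N 3%N 0%N 3%N.
Qed.

Let a2_le0 : a2 <= 0.
Proof. rewrite /a2 /p0 /pm /phi; bernstein B 0%N 4%N 0%N 3%N. Qed.

Let a3_norm : `|a3| <= x / 12.
Proof.
by rewrite ler_norml /a3 /pm /phi; apply/andP; split; bernstein B 1%N 3%N 0%N 3%N.
Qed.

Let mulr_ge_Nnorm (a d r s : R) : `|a| <= r -> `|d| <= s -> - (r * s) <= a * d.
Proof.
move=> ar ds; apply: le_trans (lerNnormlW _); last exact: lexx.
by rewrite lerN2 normrM ler_pM.
Qed.

(** E and y stand for e^z and e^-z. Once E y is replaced by 1, the difference of the two sides is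
    linear in E, y and y^2. Equality holds at x = 0, which is why the bounds on [a1] and [a3] carry
    a factor x. *)
Lemma symbol_poly_le (E y : R) :
  1 + z + z ^+ 2 / 2 + z ^+ 3 / 6 + z ^+ 4 / 24 + z ^+ 5 / 120 <= E
    <= 1 + z + z ^+ 2 / 2 + z ^+ 3 / 6 + z ^+ 4 / 24 + z ^+ 5 / 40 ->
  y <= 1 - z + z ^+ 2 / 2 - z ^+ 3 / 6 + z ^+ 4 / 24 - z ^+ 5 / 144 ->
  1 - 2 * z + 2 * z ^+ 2 - 4 / 3 * z ^+ 3 + 2 / 3 * z ^+ 4 - 4 / 15 * z ^+ 5 <= y ^+ 2
    <= 1 - 2 * z + 2 * z ^+ 2 - 4 / 3 * z ^+ 3 + 2 / 3 * z ^+ 4 - 8 / 45 * z ^+ 5 ->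
  E * y = 1 ->
  (p1 * E + p0 + pm * y) * (1 - y) * phi
    <= (1 + x) * ((E - y) / 2) - x * z * (2 + (E + y) / 2) / 3.
Proof.
move=> /andP[E1 E2] y1 /andP[yy1 yy2] Ey.
(* [e] and [v] are the midpoints of the bounds on E and y^2, whose coefficients are controlled in
   absolute value; y only needs the upper bound [u], since [a2] is nonpositive. *)
set e := 1 + z + z ^+ 2 / 2 + z ^+ 3 / 6 + z ^+ 4 / 24 + z ^+ 5 / 60.
set u := 1 - z + z ^+ 2 / 2 - z ^+ 3 / 6 + z ^+ 4 / 24 - z ^+ 5 / 144 in y1.
set v := 1 - 2 * z + 2 * z ^+ 2 - 4 / 3 * z ^+ 3 + 2 / 3 * z ^+ 4 - 2 / 9 * z ^+ 5.
have dE : `|E - e| <= z ^+ 5 / 120 by rewrite ler_norml /e; apply/andP; split; lra.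
have dyy : `|y ^+ 2 - v| <= 2 / 45 * z ^+ 5.
  by rewrite ler_norml /v; apply/andP; split; lra.
have i1 := mulr_ge_Nnorm _ _ _ _ a1_norm dE.
have i2 : 0 <= a2 * (y - u) by rewrite mulr_le0 // subr_le0.
have i3 := mulr_ge_Nnorm _ _ _ _ a3_norm dyy.
have main : 0 <= a1 * e - x / 6 * (z ^+ 5 / 120) + a2 * u + a3 * v
    - x / 12 * (2 / 45 * z ^+ 5) - 2 * x * z / 3 + (p1 - p0) * phi.
  (* The expression vanishes to first order at x = 0 and to fourth order at z = 0, so every
     Bernstein product carries x z^4. *)
  rewrite /a1 /a2 /a3 /e /u /v /p1 /p0 /pm /phi; bernstein B 1%N 3%N 4%N 4%N.
rewrite -subr_ge0.
have -> : (1 + x) * ((E - y) / 2) - x * z * (2 + (E + y) / 2) / 3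
    - (p1 * E + p0 + pm * y) * (1 - y) * phi
  = a1 * E + a2 * y + a3 * y ^+ 2 - 2 * x * z / 3 + (p1 - p0) * phi
    + p1 * phi * (E * y - 1).
  by rewrite /a1 /a2 /a3; field.
rewrite Ey subrr mulr0 addr0; lra.
Qed.

End SymbolPolynomial.

(** The exponent starts with the expansion z/2 - z^2/24 of -ln((1 - e^-z) / z); the term z^3/200 is
    slack. *)
Lemma expRN_le_taylor_compare (R : realType) (z : R) : 0 <= z <= 1 ->
  1 - expR (- z) <= z * expR (- (z / 2 - z ^+ 2 / 24 - z ^+ 3 / 200)).
Proof.
move=> z01; have /andP[z0 z1] := z01.
set t := z / 2 - z ^+ 2 / 24 - z ^+ 3 / 200.
have t01 : 0 <= t <= 1.
  have z2 : z ^+ 2 <= z by rewrite expr2 ler_piMl.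
  have z3 : z ^+ 3 <= z by rewrite exprS ler_piMr // exprn_ile1.
  have : 0 <= z ^+ 2 by exact: sqr_ge0.
  have : 0 <= z ^+ 3 by rewrite exprn_ge0.
  by rewrite /t; move=> ? ?; apply/andP; split; lra.
apply: le_trans (ler_wpM2l z0 (expRN_ge_taylor3 _ _ t01)).
have := expRN_ge_taylor5 _ _ z01.
pose B i j k l := bernstein_ge0 _ z z i j k l z01 z01.
suff : 1 - (1 - z + z ^+ 2 / 2 - z ^+ 3 / 6 + z ^+ 4 / 24 - z ^+ 5 / 120)
   <= z * (1 - t + t ^+ 2 / 2 - t ^+ 3 / 6) by lra.
rewrite /t; bernstein B 0%N 0%N 4%N 6%N.
Qed.

Section SymbolAtZero.
Variables (R : realType) (x z : R).
Hypotheses (x01 : 0 < x < 1) (z01 : 0 < z <= 1).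

(** One factor 1 - e^-z is split off; the remaining power x is at most z^x e^(-x t), and [phi]
    dominates the quadratic Taylor polynomial of e^(-x t). *)
Lemma powR_one_minus_expRN_le :
  (1 - expR (- z)) `^ (1 + x) <= z `^ x * ((1 - expR (- z)) * phi R x z).
Proof.
have /andP[x0 x1] := x01; have /andP[z0 z1] := z01.
have zz : 0 <= z <= 1 by rewrite ltW.
have q0 : 0 < 1 - expR (- z) by rewrite subr_gt0 expR_lt1 oppr_lt0.
set t := z / 2 - z ^+ 2 / 24 - z ^+ 3 / 200.
rewrite powRD; last by rewrite (gt_eqF q0) implybT.
rewrite powRr1 ?(ltW q0) // mulrCA ler_pM2l //.
have := expRN_le_taylor_compare _ _ zz; rewrite -/t => qt.
apply: (@le_trans _ _ ((z * expR (- t)) `^ x)).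
  by rewrite ge0_ler_powR ?nnegrE ?(ltW x0) ?(ltW q0) // mulr_ge0 ?expR_ge0 ?(ltW z0).
rewrite powRM ?(ltW z0) ?expR_ge0 // ler_pM2l ?powR_gt0 // -expRM mulrC mulrN.
have pz k : 0 <= z ^+ k by rewrite exprn_ge0 // ltW.
have z2 : z ^+ 2 <= z by rewrite expr2 ler_piMl // ltW.
have z3 : z ^+ 3 <= z by rewrite exprS ler_piMr ?(ltW z0) // exprn_ile1 // ltW.
have t01 : 0 <= t <= 1.
  have := pz 2%N; have := pz 3%N.
  by rewrite /t; move=> ? ?; apply/andP; split; lra.
have /andP[t0 t1] := t01.
have xt01 : 0 <= x * t <= 1 by rewrite mulr_ge0 ?(ltW x0) //= mulr_ile1 // ltW.
apply: le_trans (expRN_le_taylor2 _ _ xt01) _.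
have tt : t ^+ 2 <= z ^+ 2 / 4 - z ^+ 3 / 24.
  pose B i j k l := bernstein_ge0 _ z z i j k l zz zz.
  by rewrite /t; bernstein B 0%N 0%N 4%N 2%N.
have := ler_wpM2l (sqr_ge0 x) tt.
rewrite /phi -/t exprMn; lra.
Qed.

(* The symbol of the tempered operator at frequency 0. *)
Lemma symbol_zero_le :
  (mu_1 (1 + x) * expR z + mu_0 (1 + x) + mu_m1 (1 + x) * expR (- z))
    * (1 - expR (- z)) `^ (1 + x)
  <= z `^ x * ((1 + x) * ((expR z - expR (- z)) / 2)
                - x * z * (2 + (expR z + expR (- z)) / 2) / 3).
Proof.
have /andP[x0 x1] := x01; have /andP[z0 z1] := z01.
have xx : 0 <= x <= 1 by rewrite !ltW.
have zz : 0 <= z <= 1 by rewrite ltW.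
have y1 : expR (- z) <= 1 by rewrite expR_le1 oppr_le0 ltW.
have E1 : 1 <= expR z by rewrite -expR0 ler_expR ltW.
have y0 := expR_ge0 (- z).
have W0 : 0 <= mu_1 (1 + x) * expR z + mu_0 (1 + x) + mu_m1 (1 + x) * expR (- z).
  have : 1 / 2 <= mu_1 (1 + x) by rewrite /mu_1; nra.
  have : - (1 / 6) <= mu_0 (1 + x) by rewrite /mu_0; nra.
  have : - (1 / 24) <= mu_m1 (1 + x) by rewrite /mu_m1; nra.
  move: (mu_1 _) (mu_0 _) (mu_m1 _) => a b c; nra.
apply: le_trans (ler_wpM2l W0 powR_one_minus_expRN_le) _.
rewrite mulrCA ler_pM2l ?powR_gt0 // mulrA.
have Ey : expR z * expR (- z) = 1 by rewrite -expRD subrr expR0.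
have := symbol_poly_le _ _ _ xx zz (expR z) (expR (- z)).
rewrite (expR_ge_taylor5 _ _ zz) (expR_le_taylor4 _ _ zz) (expRN_le_taylor4 _ _ zz).
rewrite (expRN2_ge _ _ zz) (expRN2_le _ _ zz) => /(_ isT isT isT Ey).
have -> : mu_1 (1 + x) = (12 + 11 * x + 3 * x ^+ 2) / 24 by rewrite /mu_1; field.
have -> : mu_0 (1 + x) = (6 - 5 * x - 3 * x ^+ 2) / 12 by rewrite /mu_0; field.
have -> : mu_m1 (1 + x) = x * (3 * x - 1) / 24 by rewrite /mu_m1; field.
by rewrite -!mulrA.
Qed.

End SymbolAtZero.

(** * Truncated binomial series of (1 - y)^alpha *)

Section GeneratingFunction.
Variables (R : realType) (alpha : R).
Hypothesis halpha : 1 < alpha < 2.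

Lemma g_ge0 k : 0 <= g alpha k.+2.
Proof.
have /andP[a1 a2] := halpha.
elim: k => [|k IH]; rewrite gS //.
  rewrite gS // g0 // mul1r sub0r divr1 mulNr -mulrN.
  by rewrite mulr_ge0 //; lra.
rewrite mulr_ge0 // divr_ge0 // subr_ge0.
by rewrite (@le_trans _ _ 2%:R) ?ler_nat // ltW.
Qed.

Lemma g_le1 k : g alpha k.+2 <= 1.
Proof.
have /andP[a1 a2] := halpha.
elim: k => [|k IH]; rewrite gS //.
  rewrite gS // g0 // mul1r sub0r divr1 mulNr -mulrN.
  have : (alpha - 1) * (2 - alpha) >= 0 by rewrite mulr_ge0 //; lra.
  nra.
apply: le_trans IH; rewrite ler_piMr ?g_ge0 // ler_pdivrMr ?ltr0n // mul1r.
by rewrite -natr1; lra.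
Qed.

Definition gsum (m : nat) : {poly R} := \poly_(k < m.+1) g alpha k.

Lemma gsumS m : gsum m.+1 = gsum m + g alpha m.+1 *: 'X^(m.+1).
Proof. by rewrite /gsum !poly_def big_ord_recr. Qed.

(** The full series (1 - y)^alpha solves the homogeneous equation; truncation leaves a residual in
    top degree only. *)
Lemma gsum_ode m (y : R) :
  (1 - y) * (gsum m)^`().[y] + alpha * (gsum m).[y] = (alpha - m%:R) * g alpha m * y ^+ m.
Proof.
elim: m => [|m IH].
  rewrite /gsum poly_def big_ord_recr big_ord0 /= add0r expr0 alg_polyC derivC.
  by rewrite horner0 hornerC; ring.
rewrite gsumS derivD derivZ derivXn !hornerD !hornerZ hornerMn !hornerXn /=.
have gm : m.+1%:R * g alpha m.+1 = (m%:R - alpha) * g alpha m.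
  by rewrite gS // mulrC -mulrA mulfVK ?pnatr_eq0 // mulrC.
transitivity ((1 - y) * (gsum m)^`().[y] + alpha * (gsum m).[y]
  + y ^+ m * (m.+1%:R * g alpha m.+1) + (alpha - m.+1%:R) * g alpha m.+1 * y ^+ m.+1).
  by rewrite -mulr_natl exprS; ring.
by rewrite IH gm; ring.
Qed.

(** With y = 1 - e^-s, the quotient of the truncation by (1 - y)^alpha is the truncation times
    e^(alpha s). By [gsum_ode] its derivative in s is nonpositive, and it equals 1 at s = 0. *)
Lemma gsum_le m (y : R) : 0 <= y < 1 -> (gsum m.+2).[y] <= (1 - y) `^ alpha.
Proof.
move=> /andP[y0 y1]; have /andP[a1 a2] := halpha.
pose f (s : R) := - (gsum m.+2).[1 - expR (- s)] * expR (alpha * s).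
pose df (s : R) := expR (alpha * s) * ((m.+2%:R - alpha) * g alpha m.+2 * (1 - expR (- s)) ^+ m.+2).
have fdf (s : R) : is_derive s 1 f (df s).
  have dE : is_derive s 1 (fun u : R => 1 - expR (- u)) (expR (- s)).
    have -> : expR (- s) = 0 - expR (- s) * -1 by ring.
    by apply: is_deriveB; apply: is_derive1_comp.
  have dF : is_derive s 1 (fun u : R => expR (alpha * u)) (expR (alpha * s) * alpha).
    apply: (@is_derive1_comp _ expR (fun u => alpha * u)).
    have := @is_deriveZ R R R id alpha s 1 1 (is_derive_id s 1).
    by rewrite /GRing.scale /= mulr1.
  have dP : is_derive s 1 (fun u : R => - (gsum m.+2).[1 - expR (- u)])
      (- ((gsum m.+2)^`().[1 - expR (- s)] * expR (- s))).
    exact: is_deriveN.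
  have -> : df s = - (gsum m.+2).[1 - expR (- s)] *: (expR (alpha * s) * alpha)
      + expR (alpha * s) *: - ((gsum m.+2)^`().[1 - expR (- s)] * expR (- s)).
    have := gsum_ode m.+2 (1 - expR (- s)); rewrite opprB addrCA subrr addr0 => ode.
    rewrite /df /GRing.scale /= -[m.+2%:R - _]opprB !mulNr -ode; ring.
  exact: is_deriveM.
have df0 (s : R) : 0 <= s -> 0 <= df s.
  move=> s0; apply: mulr_ge0; first exact: expR_ge0.
  apply: mulr_ge0; last by rewrite exprn_ge0 // subr_ge0 expR_le1 oppr_le0.
  apply: mulr_ge0; last exact: g_ge0.
  by rewrite subr_ge0 (@le_trans _ _ 2%:R) ?ler_nat // ltW.
pose s := - ln (1 - y).
have y1' : 0 < 1 - y by rewrite subr_gt0.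
have s0 : 0 <= s by rewrite oppr_ge0 ln_le0 //; lra.
have := is_derive_nneg_le _ f df (fun t _ => fdf t) df0 s s0.
rewrite /f oppr0 expR0 subrr mulr0 expR0 mulr1 /s opprK lnK ?posrE //.
have -> : (gsum m.+2).[0] = 1.
  by rewrite horner_coef0 coef_poly g0.
rewrite opprB addrCA subrr addr0 mulNr lerN2 mulrN expRN.
rewrite ler_pdivrMr ?expR_gt0 // mul1r.
by rewrite /powR gt_eqF.
Qed.

End GeneratingFunction.

(** * Untempered compact weights and their generating function *)

Section CompactWeights.
Variables (R : realType) (alpha : R).
Hypothesis halpha : 1 < alpha < 2.

(** Taking lambda = h = 0 turns every exponential factor into 1. *)
Definition omega (k : nat) : R := w alpha 0 0 k.
Arguments omega : simpl never.

Lemma omega0 : omega 0 = mu_1 alpha * g alpha 0.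
Proof. by rewrite /omega /w mul0r expR0 mulr1. Qed.

Lemma omega1 : omega 1 = mu_1 alpha * g alpha 1 + mu_0 alpha * g alpha 0.
Proof. by []. Qed.

Lemma omegaSS j : omega j.+2
  = mu_1 alpha * g alpha j.+2 + mu_0 alpha * g alpha j.+1 + mu_m1 alpha * g alpha j.
Proof. by rewrite /omega /w !mulr0 expR0 mulr1. Qed.

Lemma w_omega (lambda h : R) k : w alpha lambda h k = omega k * expR ((1 - k%:R) * (lambda * h)).
Proof.
case: k => [|[|k]].
- by rewrite omega0 subr0 mul1r.
- by rewrite omega1 subrr mul0r expR0 mulr1.
- by rewrite omegaSS /w -[in LHS](mulrA _ lambda h).
Qed.

Lemma mu_bounds : [/\ 1 / 2 <= mu_1 alpha, - (1 / 6) <= mu_0 alpha <= 1 / 2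
  & - (1 / 12) <= mu_m1 alpha <= 1 / 12].
Proof.
have /andP[a1 a2] := halpha.
have h : 0 <= (alpha - 1) * (2 - alpha) by rewrite mulr_ge0 //; lra.
have h2 : 0 <= (alpha - 1) ^+ 2 by exact: sqr_ge0.
split; first by rewrite /mu_1; lra.
  by apply/andP; split; rewrite /mu_0; lra.
by apply/andP; split; rewrite /mu_m1; lra.
Qed.

Lemma mu_sum : mu_1 alpha + mu_0 alpha + mu_m1 alpha = 1.
Proof. by rewrite /mu_1 /mu_0 /mu_m1; field. Qed.

(** By the recurrence, the weight is a nonnegative multiple of [g alpha k.+2] times a quadratic in
    k. Its leading coefficient is 1 by [mu_sum]; the other two are nonnegative polynomials in alpha
    - 1 on [0, 1]. *)
Lemma omega_ge0 k : 0 <= omega k.+4.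
Proof.
have /andP[a1 a2] := halpha.
rewrite omegaSS.
have e3 : g alpha k.+3 = g alpha k.+2 * ((k.+2%:R - alpha) / k.+3%:R) by rewrite gS.
have e4 : g alpha k.+4 = g alpha k.+3 * ((k.+3%:R - alpha) / k.+4%:R) by rewrite gS.
rewrite e4 e3.
have n0 : 0 <= k%:R :> R by [].
have -> : k.+2%:R = k%:R + 2 :> R by rewrite -!natr1; ring.
have -> : k.+3%:R = k%:R + 3 :> R by rewrite -!natr1; ring.
have -> : k.+4%:R = k%:R + 4 :> R by rewrite -!natr1; ring.
move: (k%:R) n0 => n n0.
have -> : mu_1 alpha * (g alpha k.+2 * ((n + 2 - alpha) / (n + 3)) * ((n + 3 - alpha) / (n + 4)))
  + mu_0 alpha * (g alpha k.+2 * ((n + 2 - alpha) / (n + 3))) + mu_m1 alpha * g alpha k.+2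
  = g alpha k.+2 / ((n + 3) * (n + 4)) *
    (mu_1 alpha * (n + 2 - alpha) * (n + 3 - alpha) + mu_0 alpha * (n + 2 - alpha) * (n + 4)
     + mu_m1 alpha * (n + 3) * (n + 4)).
  by field; rewrite !gt_eqF //; lra.
apply: mulr_ge0.
  by apply: divr_ge0; [exact: g_ge0|apply: mulr_ge0; lra].
have -> : mu_1 alpha * (n + 2 - alpha) * (n + 3 - alpha) + mu_0 alpha * (n + 2 - alpha) * (n + 4)
     + mu_m1 alpha * (n + 3) * (n + 4)
  = n ^+ 2 + n * (mu_1 alpha * (5 - 2 * alpha) + mu_0 alpha * (6 - alpha) + mu_m1 alpha * 7)
    + (mu_1 alpha * (2 - alpha) * (3 - alpha) + 4 * mu_0 alpha * (2 - alpha) + 12 * mu_m1 alpha)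
    + (mu_1 alpha + mu_0 alpha + mu_m1 alpha - 1) * n ^+ 2 by ring.
rewrite mu_sum subrr mul0r addr0.
have b01 : 0 <= alpha - 1 <= 1 by apply/andP; split; lra.
have B0 i j := bernstein_ge0 R (alpha - 1) (alpha - 1) i j 0 0 b01 b01.
apply: addr_ge0; first apply: addr_ge0; first exact: sqr_ge0.
  apply: mulr_ge0 => //; rewrite /mu_1 /mu_0 /mu_m1.
  move: (B0 0%N 4%N) (B0 1%N 3%N) (B0 2%N 2%N) (B0 3%N 1%N) (B0 4%N 0%N).
  by rewrite !exprS !expr0; lra.
rewrite /mu_1 /mu_0 /mu_m1.
move: (B0 0%N 5%N) (B0 1%N 4%N) (B0 2%N 3%N) (B0 3%N 2%N) (B0 4%N 1%N) (B0 5%N 0%N).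
by rewrite !exprS !expr0; lra.
Qed.

Definition osum (m : nat) : {poly R} := \poly_(k < m) omega k.

(** The three truncations are staggered so that every product stops at degree m + 2. *)
Lemma osum_gsum m : osum m.+3
  = mu_1 alpha *: gsum _ alpha m.+2 + mu_0 alpha *: ('X * gsum _ alpha m.+1)
    + mu_m1 alpha *: ('X^2 * gsum _ alpha m).
Proof.
apply/polyP => -[|[|k]]; rewrite !coefD !coefZ coefXM coefXnM /= !coef_poly !ltnS //=.
- by rewrite omega0 !mulr0 !addr0.
- by rewrite omega1 !mulr0 !addr0.
- rewrite subSS subSS subn0; case: ifP => _; first by rewrite omegaSS.
  by rewrite !mulr0 !addr0.
Qed.

(** All three truncations are completed to the longest one. The added terms may have negative
    coefficients, as [mu_0] >= -1/6 and [mu_m1] >= -1/12 only, but the resulting loss is at most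
    y^m. *)
Lemma osum_le_tail m (y : R) : 0 <= y < 1 ->
  (osum m.+4).[y]
    <= (mu_1 alpha + mu_0 alpha * y + mu_m1 alpha * y ^+ 2) * (1 - y) `^ alpha + y ^+ m.
Proof.
move=> y01; have /andP[y0 y1] := y01.
have y1' := ltW y1.
rewrite osum_gsum !hornerD !hornerZ !hornerM !hornerX.
have [m1 /andP[m0l m0u] /andP[mml mmu]] := mu_bounds.
have P0 : 0 <= mu_1 alpha + mu_0 alpha * y + mu_m1 alpha * y ^+ 2.
  have : y ^+ 2 <= 1 by rewrite exprn_ile1.
  have : 0 <= y ^+ 2 by exact: sqr_ge0.
  move: (y ^+ 2) => u; nra.
have := ler_wpM2l P0 (gsum_le _ _ halpha m.+1 _ y01).
rewrite (gsumS _ _ m.+2) (gsumS _ _ m.+1) !hornerD !hornerZ !hornerXn => bound.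
have ym : 0 <= y ^+ m by rewrite exprn_ge0.
have tail j i : 0 <= g alpha j.+2 * y ^+ (m + i) <= y ^+ m.
  have g0 := g_ge0 _ _ halpha j; have y0i := exprn_ge0 (m + i) y0.
  apply/andP; split; first exact: mulr_ge0.
  rewrite -[leRHS]mul1r; apply: ler_pM => //; first exact: g_le1.
  by rewrite exprD ler_piMr // exprn_ile1.
have /andP[a1 a2] := tail m.+1 4%N.
have /andP[b1 b2] := tail m.+1 5%N.
have /andP[c1 c2] := tail m 4%N.
have ha : 0 <= (mu_0 alpha + 1 / 6) * (g alpha m.+3 * y ^+ (m + 4)) by rewrite mulr_ge0 //; lra.
have hb : 0 <= (mu_m1 alpha + 1 / 12) * (g alpha m.+3 * y ^+ (m + 5)) by rewrite mulr_ge0 //; lra.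
have hc : 0 <= (mu_m1 alpha + 1 / 12) * (g alpha m.+2 * y ^+ (m + 4)) by rewrite mulr_ge0 //; lra.
move: bound ha hb hc a2 b2 c2.
rewrite !exprS !expr0 !exprD !exprS !expr0; lra.
Qed.

(** From index 4 on the weights are nonnegative, so [osum] increases with its length, while the
    error y^m of [osum_le_tail] tends to 0. *)
Lemma osum_le m (y : R) : 0 <= y < 1 ->
  (osum m.+4).[y] <= (mu_1 alpha + mu_0 alpha * y + mu_m1 alpha * y ^+ 2) * (1 - y) `^ alpha.
Proof.
move=> y01; have /andP[y0 y1] := y01.
have mono i : (osum m.+4).[y] <= (osum (m + i).+4).[y].
  elim: i => [|i IH]; first by rewrite addn0.
  apply: le_trans IH _; rewrite addnS /osum !poly_def [X in _ <= X.[_]]big_ord_recr /=.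
  by rewrite hornerD hornerZ hornerXn lerDl; apply: mulr_ge0; [exact: omega_ge0|exact: exprn_ge0].
set L := (X in _ <= X).
have cv : (((L + y ^+ (m + n))%R @[n --> \oo]) --> (L + 0)%R)%classic.
  apply: cvgD; first exact: cvg_cst.
  have := @cvg_expr R y; rewrite ger0_norm // => /(_ y1).
  by rewrite -(cvg_shiftn m); under eq_fun do rewrite addnC.
rewrite -[L]addr0; apply: (ler_cvg_to (cvg_cst _) cv); apply: nearW => n.
exact: le_trans (mono n) (osum_le_tail _ _ y01).
Qed.

Lemma osum1_le m : (osum m.+4).[1] <= 0.
Proof.
have /andP[a1 a2] := halpha.
(* The quadratic factor in [osum_le] is at most 2 and (1 - y)^alpha <= 1 - y, so Q is nonpositive on
   [0, 1); continuity carries the sign to 1. *)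
pose Q : {poly R} := osum m.+4 - 2 *: (1 - 'X).
have Qle (y : R) : 0 <= y < 1 -> Q.[y] <= 0.
  move=> y01; have /andP[y0 y1] := y01.
  rewrite /Q hornerD hornerN hornerZ hornerD hornerN hornerX hornerC subr_le0.
  apply: le_trans (osum_le _ _ y01) _.
  have [_ /andP[m0l m0u] /andP[mml mmu]] := mu_bounds.
  apply: ler_pM; rewrite ?powR_ge0 //; last 2 first.
  - have y2 : y ^+ 2 <= 1 by rewrite exprn_ile1 // ltW.
    have y2' : 0 <= y ^+ 2 by exact: sqr_ge0.
    have : mu_1 alpha <= 7 / 6 by rewrite /mu_1; nra.
    by move: (y ^+ 2) y2 y2' => u ? ?; nra.
  - by apply: ge1r_powR; [rewrite subr_gt0 y1 gerBl|exact: ltW].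
  have [m1 _ _] := mu_bounds.
  have y2 : y ^+ 2 <= 1 by rewrite exprn_ile1 // ltW.
  have y2' : 0 <= y ^+ 2 by exact: sqr_ge0.
  by move: (y ^+ 2) y2 y2' => u ? ?; nra.
suff : Q.[1] <= 0.
  by rewrite /Q hornerD hornerN hornerZ hornerD hornerN hornerX hornerC subrr mulr0 subr0.
have cQ : {for 1, continuous (horner Q)}.
  by apply: differentiable_continuous; apply/derivable1_diffP; apply: ex_derive.
have cu : (((1 - harmonic n)%R @[n --> \oo]) --> (1 - 0 : R)%R)%classic.
  by apply: cvgB; [exact: cvg_cst|exact: cvg_harmonic].
rewrite subr0 in cu.
have cQu : ((Q.[1 - harmonic n]%R @[n --> \oo]) --> Q.[1]%R)%classic.
  exact: (cvg_comp _ _ cu cQ).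
apply: (ler_cvg_to cQu (cvg_cst _)); apply: nearW => n /=.
apply: Qle; rewrite /harmonic /=.
by rewrite subr_ge0 invf_le1 ?ltr0n // ler1n /= ltrBlDr ltrDl invr_gt0 ltr0n.
Qed.

End CompactWeights.

(** * Coefficients of the first and second autocorrelations *)

Section CorrelationCoefficients.
Variables (R : realFieldType) (x z : R).
Hypotheses (x01 : 0 <= x <= 1) (z01 : 0 <= z <= 1).

Let p1 : R := (12 + 11 * x + 3 * x ^+ 2) / 24.
Let p0 : R := (6 - 5 * x - 3 * x ^+ 2) / 12.
Let pm : R := x * (3 * x - 1) / 24.
(** At alpha = 1 + x, [g2] is the second Gruenwald weight, and [o2], [o3] are [omega] at 2 and 3.
    [q] is an upper bound of z^x; [cE] and [cy] are the coefficients of E and y in [kappa] once z^x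
    is replaced by [q]. *)
Let g2 : R := (1 + x) * x / 2.
Let o2 : R := p1 * g2 - p0 * (1 + x) + pm.
Let o3 : R := p1 * (g2 * (1 - x) / 3) + p0 * g2 - pm * (1 + x).
Let q : R := 1 - x + x * z.
Let cE : R := p1 - (1 + x) * q / 2 + x * z * q / 6.
Let cy : R := o2 + (1 + x) * q / 2 + x * z * q / 6.

Let B i j k l := bernstein_ge0 _ x z i j k l x01 z01.

Variables (E y zp : R).
Hypothesis E_ge : 1 + z + z ^+ 2 / 2 + z ^+ 3 / 6 <= E.
Hypothesis y_ge : 1 - z + z ^+ 2 / 2 - z ^+ 3 / 6 <= y.
Hypothesis y_le : y <= 1 - z / 2.
Hypothesis yy : 1 - 2 * z + 2 * z ^+ 2 - 4 / 3 * z ^+ 3 + 2 / 3 * z ^+ 4 - 4 / 15 * z ^+ 5 <= y ^+ 2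
    <= 1 - 2 * z + 2 * z ^+ 2 - 4 / 3 * z ^+ 3 + 2 / 3 * z ^+ 4 - 8 / 45 * z ^+ 5.
Hypothesis zp_le : zp <= q.

Let kappa : R :=
  p1 * E + o2 * y - (1 + x) * zp * ((E - y) / 2) + x * z * zp * ((E + y) / 2) / 3.

Let cE_ge0 : 0 <= cE.
Proof. rewrite /cE /p1 /q; bernstein B 1%N 1%N 0%N 2%N. Qed.

Let cy_ge0 : 0 <= cy.
Proof. rewrite /cy /o2 /g2 /p1 /p0 /pm /q; bernstein B 1%N 3%N 0%N 2%N. Qed.

Let o3_norm : `|o3| <= x * (2 / 5).
Proof.
rewrite ler_norml /o3 /g2 /p1 /p0 /pm; apply/andP; split; bernstein B 1%N 4%N 0%N 0%N.
Qed.

(** Since z (E + y) <= 3 (E - y), [kappa] decreases in [zp], which may therefore be raised to [q].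
    Then E and y are lowered to their Taylor bounds, as [cE] and [cy] are nonnegative. *)
Let kappa_ge : cE * (1 + z + z ^+ 2 / 2 + z ^+ 3 / 6) + cy * (1 - z + z ^+ 2 / 2 - z ^+ 3 / 6)
  <= kappa.
Proof.
have /andP[x0 x1] := x01; have /andP[z0 z1] := z01.
have iE : 0 <= cE * (E - (1 + z + z ^+ 2 / 2 + z ^+ 3 / 6)) by rewrite mulr_ge0 ?subr_ge0.
have iy : 0 <= cy * (y - (1 - z + z ^+ 2 / 2 - z ^+ 3 / 6)) by rewrite mulr_ge0 ?subr_ge0.
have z2 : 0 <= z ^+ 2 by exact: sqr_ge0.
have z3 : 0 <= z ^+ 3 by rewrite exprn_ge0.
have Ey : z * (E + y) <= 3 * (E - y).
  have h1 : 0 <= (3 - z) * (E - 1 - z) by apply: mulr_ge0; [lra|have := E_ge; lra].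
  have h2 : 0 <= (3 + z) * (1 - z / 2 - y) by apply: mulr_ge0; [lra|have := y_le; lra].
  have z2z : z ^+ 2 <= z by rewrite expr2 ler_piMl.
  move: h1 h2; lra.
have xEy : x * (z * (E + y)) <= (1 + x) * (3 * (E - y)).
  have S0 : 0 <= 3 * (E - y) by have := E_ge; have := y_le; lra.
  have := ler_wpM2l x0 Ey; lra.
have iz : 0 <= (q - zp) * ((1 + x) * (3 * (E - y)) - x * (z * (E + y))).
  by rewrite mulr_ge0 // subr_ge0.
move: iE iy iz; rewrite /kappa /cE /cy; lra.
Qed.

Lemma kappa_poly_ge0 : 0 <= kappa.
Proof.
apply: le_trans kappa_ge; rewrite /cE /cy /o2 /g2 /p1 /p0 /pm /q.
bernstein B 1%N 3%N 0%N 4%N.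
Qed.

(** The factor 4 is the constant of [corr2_ge]. The sign of [o3] depends on x, so y^2 is replaced by
    the midpoint of a two-sided bound. *)
Lemma kappa_omega3_poly_ge0 : 0 <= kappa + 4 * (o3 * y ^+ 2).
Proof.
set v := 1 - 2 * z + 2 * z ^+ 2 - 4 / 3 * z ^+ 3 + 2 / 3 * z ^+ 4 - 2 / 9 * z ^+ 5.
have dyy : `|y ^+ 2 - v| <= 2 / 45 * z ^+ 5.
  by have /andP[yy1 yy2] := yy; rewrite ler_norml /v; apply/andP; split; lra.
have i3 : - (x * (2 / 5) * (2 / 45 * z ^+ 5)) <= o3 * (y ^+ 2 - v).
  by apply: lerNnormlW; rewrite normrM ler_pM.
suff : 0 <= cE * (1 + z + z ^+ 2 / 2 + z ^+ 3 / 6) + cy * (1 - z + z ^+ 2 / 2 - z ^+ 3 / 6)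
    + 4 * (o3 * v) - 4 * (x * (2 / 5) * (2 / 45 * z ^+ 5)) by have := kappa_ge; lra.
rewrite /cE /cy /o3 /v /o2 /g2 /p1 /p0 /pm /q; bernstein B 1%N 4%N 0%N 5%N.
Qed.

End CorrelationCoefficients.

(** As a function of x, z^x is convex, and the right side is its chord between x = 0 and x = 1. The
    proof weights two instances of 1 + s <= e^s by x and 1 - x, so that the terms in ln z cancel. *)
Lemma powR_le_chord (R : realType) (x z : R) : 0 < x < 1 -> 0 <= z -> z `^ x <= 1 - x + x * z.
Proof.
move=> /andP[x0 x1]; rewrite le_eqVlt => /predU1P[<-|z0].
  by rewrite powR0 ?gt_eqF // mulr0 addr0 subr_ge0 ltW.
rewrite /powR gt_eqF //; set t := ln z.
have e1 := expR_ge1Dx ((1 - x) * t); have e2 := expR_ge1Dx (- (x * t)).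
have E0 := expR_gt0 (x * t).
have zE : z = expR (x * t) * expR ((1 - x) * t).
  by rewrite -expRD -mulrDl addrC subrK mul1r lnK.
have oE : 1 = expR (x * t) * expR (- (x * t)) by rewrite -expRD subrr expR0.
have h1 := ler_wpM2l (ltW x0) (ler_wpM2l (ltW E0) e1).
have x1' : 0 <= 1 - x by rewrite subr_ge0 ltW.
have h2 := ler_wpM2l x1' (ler_wpM2l (ltW E0) e2).
rewrite -zE in h1; rewrite -oE in h2.
move: (expR (x * t)) h1 h2 => e; lra.
Qed.

(** * Signs and total of the tempered coefficients *)

Section TemperedWeights.
Variables (R : realType) (alpha z : R).
Hypotheses (halpha : 1 < alpha < 2) (z01 : 0 <= z <= 1).

Let E := expR z.
Let y := expR (- z).
Let zp := z `^ (alpha - 1).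

Let Ey : E * y = 1. Proof. by rewrite -expRD subrr expR0. Qed.

(* The coefficient of sum_i v_i v_(i+1) in h^alpha times the quadratic form of
   the spatial operator; z = lambda h. *)
Definition kappa : R := omega _ alpha 0 * E + omega _ alpha 2 * y
  - alpha * zp * ((E - y) / 2) + (alpha - 1) * z * zp * ((E + y) / 2) / 3.

Let hyps : [/\ 0 <= alpha - 1 <= 1, 1 + z + z ^+ 2 / 2 + z ^+ 3 / 6 <= E,
  1 - z + z ^+ 2 / 2 - z ^+ 3 / 6 <= y, y <= 1 - z / 2 & zp <= 1 - (alpha - 1) + (alpha - 1) * z].
Proof.
have /andP[a1 a2] := halpha; have /andP[z0 z1] := z01.
have z4 : 0 <= z ^+ 4 by rewrite exprn_ge0.
have z5 : 0 <= z ^+ 5 by rewrite exprn_ge0.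
split.
- by apply/andP; split; lra.
- have := expR_ge_taylor5 _ _ z01; rewrite -/E; lra.
- exact: expRN_ge_taylor3.
- have := expRN_le_taylor2 _ _ z01; have : z ^+ 2 <= z by rewrite expr2 ler_piMl.
  by rewrite -/y; lra.
- by apply: powR_le_chord => //; apply/andP; split; lra.
Qed.

Let g1E : g alpha 1 = - alpha.
Proof. by rewrite gS // g0 // mul1r sub0r divr1. Qed.

Let g2E : g alpha 2 = alpha * (alpha - 1) / 2.
Proof. by rewrite gS // g1E; field. Qed.

Let g3E : g alpha 3 = alpha * (alpha - 1) / 2 * (1 - (alpha - 1)) / 3.
Proof. by rewrite gS // g2E; field. Qed.

Lemma kappa_ge0 : 0 <= kappa.
Proof.
have [x01 E1 y1 y2 q1] := hyps.
have := kappa_poly_ge0 _ _ _ x01 z01 E y zp E1 y1 y2 q1.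
by congr (0 <= _); rewrite /kappa omega0 omegaSS g1E g2E g0 // /mu_1 /mu_0 /mu_m1; field.
Qed.

Lemma kappa_omega3_ge0 : 0 <= kappa + 4 * (omega _ alpha 3 * y ^+ 2).
Proof.
have [x01 E1 y1 y2 q1] := hyps.
have yy := introT andP (conj (expRN2_ge _ _ z01) (expRN2_le _ _ z01)).
have := kappa_omega3_poly_ge0 _ _ _ x01 z01 E y zp E1 y1 y2 yy q1.
by congr (0 <= _); rewrite /kappa omega0 !omegaSS g3E g1E g2E g0 // /mu_1 /mu_0 /mu_m1; field.
Qed.

(** At frequency 0 all autocorrelations count equally: [osum_le] bounds the sum of the weights by
    the generating function at e^-z, and [symbol_zero_le] compares that with the lambda terms. *)
Lemma total_weight_le0 m :
  \sum_(k < m.+4) omega _ alpha k * expR ((1 - k%:R) * z)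
    - alpha * zp * ((E - y) / 2) + (alpha - 1) * z * zp * (2 + (E + y) / 2) / 3 <= 0.
Proof.
have /andP[a1 a2] := halpha; have /andP[z0 z1] := z01.
have -> : \sum_(k < m.+4) omega _ alpha k * expR ((1 - k%:R) * z) = E * (osum _ alpha m.+4).[y].
  rewrite /osum horner_poly mulr_sumr; apply: eq_bigr => k _.
  by rewrite mulrCA -expRM_natl -expRD; congr (_ * expR _); ring.
(* At z = 0 one has y = 1, outside the range of [osum_le]; there the lambda terms vanish and
   [osum1_le] applies. *)
move: z0; rewrite le_eqVlt => /predU1P[z0|z0].
  have z00 : z = 0 by [].
  rewrite /zp /E /y z00 oppr0 expR0 powR0; last by rewrite gt_eqF // subr_gt0.
  by rewrite !(mulr0, mul0r, subr0, addr0) mul1r osum1_le.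
have y01 : 0 <= y < 1 by rewrite expR_ge0 expR_lt1 oppr_lt0.
have := ler_wpM2l (expR_ge0 z) (osum_le _ _ halpha m _ y01).
have x01 : 0 < alpha - 1 < 1 by apply/andP; split; lra.
have zz : 0 < z <= 1 by rewrite z0.
have := symbol_zero_le _ _ _ x01 zz.
rewrite (_ : 1 + (alpha - 1) = alpha) -/E -/y -/zp; last by ring.
have -> : (mu_1 alpha * E + mu_0 alpha + mu_m1 alpha * y) * (1 - y) `^ alpha
  = E * ((mu_1 alpha + mu_0 alpha * y + mu_m1 alpha * y ^+ 2) * (1 - y) `^ alpha)
    + (1 - E * y) * ((mu_0 alpha + mu_m1 alpha * y) * (1 - y) `^ alpha) by ring.
rewrite Ey subrr mul0r addr0; lra.
Qed.

End TemperedWeights.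

(** * Autocorrelations of a grid function *)

Section Correlations.
Variables (R : realFieldType) (M : nat) (v : nat -> R).

Definition corr (k : nat) : R := \sum_(i < M) v i * v (i + k)%N.

Hypothesis v0 : v 0 = 0.
Hypothesis vM : forall i, (M <= i)%N -> v i = 0.

Lemma corr0E : corr 0 = \sum_(i < M) v i ^+ 2.
Proof. by apply: eq_bigr => i _; rewrite addn0 -expr2. Qed.

Lemma corr0_ge0 : 0 <= corr 0.
Proof. by rewrite corr0E; apply: sumr_ge0 => i _; exact: sqr_ge0. Qed.

Lemma sum_shift (f : nat -> R) k : (forall i, (M <= i)%N -> f i = 0) ->
  \sum_(i < M) f (i + k)%N = \sum_(i < M) f i - \sum_(i < k) f i.
Proof.
move=> fM; elim: k => [|k IH].
  by rewrite big_ord0 subr0; apply: eq_bigr => i _; rewrite addn0.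
rewrite big_ord_recr /= opprD addrA -IH.
have := @big_ord_recl R 0 +%R M (fun i : 'I_M.+1 => f (i + k)%N); rewrite big_ord_recr /= add0n.
rewrite (fM (M + k)%N) ?leq_addr // addr0 => ->.
rewrite addrC addKr; apply: eq_bigr => i _; rewrite /bump /=; congr f.
by rewrite add1n addnS addSn.
Qed.

Lemma corr_le k : corr k <= corr 0.
Proof.
have : \sum_(i < M) v i * v (i + k)%N <= \sum_(i < M) (v i ^+ 2 + v (i + k)%N ^+ 2) / 2.
  by apply: ler_sum => i _; have := sqr_ge0 (v i - v (i + k)%N); lra.
rewrite -mulr_suml big_split /= (sum_shift (fun i => v i ^+ 2)); last first.
  by move=> i /vM ->; rewrite expr0n.
have : 0 <= \sum_(i < k) v i ^+ 2 by apply: sumr_ge0 => i _; exact: sqr_ge0.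
rewrite corr0E /corr; lra.
Qed.

Lemma corr_geN k : - corr 0 <= corr k.
Proof.
have : \sum_(i < M) - ((v i ^+ 2 + v (i + k)%N ^+ 2) / 2) <= \sum_(i < M) v i * v (i + k)%N.
  by apply: ler_sum => i _; have := sqr_ge0 (v i + v (i + k)%N); lra.
rewrite sumrN -mulr_suml big_split /= (sum_shift (fun i => v i ^+ 2)); last first.
  by move=> i /vM ->; rewrite expr0n.
have : 0 <= \sum_(i < k) v i ^+ 2 by apply: sumr_ge0 => i _; exact: sqr_ge0.
rewrite corr0E /corr; lra.
Qed.

(* On the Fourier side: 1 - cos (2 t) <= 4 (1 - cos t). *)
Lemma corr2_ge : corr 0 - corr 2 <= 4 * (corr 0 - corr 1).
Proof.
have sq k : \sum_(i < M) (v i - v (i + k)%N) ^+ 2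
    = 2 * corr 0 - \sum_(i < k) v i ^+ 2 - 2 * corr k.
  have -> : \sum_(i < M) (v i - v (i + k)%N) ^+ 2
    = \sum_(i < M) v i ^+ 2 + \sum_(i < M) v (i + k)%N ^+ 2
      - 2 * \sum_(i < M) v i * v (i + k)%N.
    by rewrite -big_split mulr_sumr -sumrB /=; apply: eq_bigr => i _; ring.
  rewrite (sum_shift (fun i => v i ^+ 2)); last by move=> i /vM ->; rewrite expr0n.
  by rewrite corr0E /corr; ring.
have s1 := sq 1; have s2 := sq 2.
have : \sum_(i < M) (v i - v (i + 2)%N) ^+ 2 <= 2 * \sum_(i < M) (v i - v (i + 1)%N) ^+ 2
    + 2 * \sum_(i < M) (v (i + 1)%N - v (i + 1 + 1)%N) ^+ 2.
  rewrite !mulr_sumr -big_split /=; apply: ler_sum => i _; rewrite -addnA.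
  have := sqr_ge0 (v i - v (i + 1)%N - (v (i + 1)%N - v (i + (1 + 1))%N)).
  by move: (v i) (v (i + 1)%N) (v (i + (1 + 1))%N) => p q r; nra.
rewrite (sum_shift (fun i => (v i - v (i + 1)%N) ^+ 2)); last first.
  by move=> i iM; rewrite !vM ?(leq_trans iM) ?leq_addr // subrr expr0n.
move: s1 s2; rewrite !big_ord_recr !big_ord0 /= v0 => -> ->.
rewrite add0n expr0n /= !add0r; have := sqr_ge0 (v 1); lra.
Qed.

(** Nonnegative coefficients allow T_k <= T_0. If w3 < 0, [corr2_ge] gives w3 T_2 <= w3 (4 T_1 - 3
    T_0), and T_1 then has the nonnegative coefficient c + 4 w3. *)
Lemma weighted_corr_le (c w3 s : R) (a : nat -> R) n :
  0 <= c -> 0 <= c + 4 * w3 -> (forall k, 0 <= a k) ->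
  s + c + w3 + \sum_(k < n) a k <= 0 ->
  s * corr 0 + c * corr 1 + w3 * corr 2 + \sum_(k < n) a k * corr k.+3 <= 0.
Proof.
move=> c0 cw a0 tot; have T0 := corr0_ge0.
have h1 : \sum_(k < n) a k * corr k.+3 <= (\sum_(k < n) a k) * corr 0.
  by rewrite mulr_suml; apply: ler_sum => k _; apply: ler_wpM2l => //; exact: corr_le.
have h2 : c * corr 1 + w3 * corr 2 <= (c + w3) * corr 0.
  have [w0|w0] := leP 0 w3.
    by rewrite mulrDl lerD // ler_wpM2l // corr_le.
  have := corr2_ge; have := corr_le 1; nra.
have h3 := ler_wpM2r T0 tot; rewrite mul0r in h3.
apply: le_trans h3; rewrite !mulrDl in h1 h2 *; lra.
Qed.

End Correlations.

Lemma corr_pred (R : realFieldType) (M : nat) (v : nat -> R) :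
  v 0 = 0 -> (forall i, (M <= i)%N -> v i = 0) -> \sum_(i < M) v i * v i.-1 = corr R M v 1.
Proof.
move=> v0; rewrite /corr; case: M => [|m] vm; first by rewrite !big_ord0.
rewrite big_ord_recl big_ord_recr /= v0 mul0r add0r (vm (m + 1)%N) ?addn1 // mulr0 addr0.
by apply: eq_bigr => i _; rewrite /bump /= add1n addn1 mulrC.
Qed.

Lemma sum_interior (R : realFieldType) (M : nat) (F : nat -> R) :
  (0 < M)%N -> F 0 = 0 -> \sum_(1 <= i < M) F i = \sum_(i < M) F i.
Proof. by move=> M0 F0; rewrite -(big_mkord xpredT F) big_ltn // F0 add0r. Qed.

(** * Dissipativity of the spatial operator *)

Section SpatialForm.
Variables (R : realType) (alpha lambda h : R) (M : nat) (v : nat -> R).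
Hypotheses (halpha : 1 < alpha < 2) (hlambda : 0 <= lambda) (h_gt0 : 0 < h).
Hypotheses (M_gt0 : (0 < M)%N) (v0 : v 0 = 0) (vM : forall i, (M <= i)%N -> v i = 0).

Let z := lambda * h.
Let E := expR z.
Let y := expR (- z).
Let T k := corr _ M v k.

Lemma compactB_form : \sum_(1 <= i < M) v i * compactB lambda h v i
  = 2 / 3 * T 0 + (E + y) / 2 / 3 * T 1.
Proof.
rewrite sum_interior ?v0 ?mul0r //.
rewrite /T -[corr _ _ _ 1]/(T 1).
have -> : \sum_(i < M) v i * compactB lambda h v i = \sum_(i < M) 1 / 6 * E * (v i * v i.-1)
   + \sum_(i < M) 2 / 3 * (v i * v (i + 0)%N) + \sum_(i < M) 1 / 6 * y * (v i * v (i + 1)%N).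
  rewrite -!big_split /=; apply: eq_bigr => i _.
  by rewrite /compactB addn0 addn1 -/z -/E -/y; ring.
by rewrite -!mulr_sumr corr_pred // -/(corr _ M v 0) -/(corr _ M v 1) -/(T 0) -/(T 1); field.
Qed.

Lemma convolution_form (a : nat -> R) :
  \sum_(1 <= i < M) v i * \sum_(0 <= k < (M - i + 1).+1) a k * v (i + k - 1)%N
  = a 0%N * T 1 + \sum_(k < M.+3) a k.+1 * T k.
Proof.
(* As v vanishes from index M on, the range of k can be made independent of i, which allows the sums
   to be exchanged. *)
have ext i : (1 <= i < M)%N -> v i * (\sum_(0 <= k < (M - i + 1).+1) a k * v (i + k - 1)%N)
    = v i * \sum_(k < M.+4) a k * v (i + k - 1)%N.
  move=> /andP[i1 iM]; congr (_ * _).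
  rewrite -(big_mkord xpredT (fun k => a k * v (i + k - 1)%N)).
  rewrite [RHS](@big_cat_nat _ _ _ (M - i + 1).+1) //=; last by lia.
  rewrite [X in _ = _ + X]big_nat_cond [X in _ = _ + X]big1 ?addr0 // => k /andP[/andP[k1 k2] _].
  by rewrite vM ?mulr0 //; lia.
rewrite (eq_big_nat _ _ ext) (sum_interior _ _ (fun i => v i * _)) ?v0 ?mul0r //.
under eq_bigr do rewrite mulr_sumr.
rewrite exchange_big /= big_ord_recl /=; congr (_ + _).
  rewrite /T -(corr_pred _ _ _ v0 vM) mulr_sumr; apply: eq_bigr => i _.
  by rewrite addn0 subn1 mulrCA.
apply: eq_bigr => k _; rewrite /T /corr mulr_sumr; apply: eq_bigr => i _.
by rewrite /bump /= add1n addnS subn1 mulrCA.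
Qed.

(** Up to the factor h^-alpha, everything depends on z = lambda h, and the form is a combination of
    autocorrelations covered by [weighted_corr_le]. *)
Lemma spatial_op_le0_padded : z <= 1 ->
  \sum_(1 <= i < M) v i * spatial_op alpha lambda h M v i <= 0.
Proof.
move=> z1; have /andP[a1 a2] := halpha.
have z0 : 0 <= z by rewrite mulr_ge0 // ltW.
have z01 : 0 <= z <= 1 by rewrite z0.
set zp := z `^ (alpha - 1).
have ha0 : 0 < h `^ alpha by rewrite powR_gt0.
have hx0 : 0 < h `^ (alpha - 1) by rewrite powR_gt0.
have hE : h * h `^ (alpha - 1) = h `^ alpha by rewrite mulr_powRB1 ?(ltW h_gt0) //; lra.
have lE : lambda * lambda `^ (alpha - 1) = lambda `^ alpha by rewrite mulr_powRB1 //; lra.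
have zpE : zp = lambda `^ (alpha - 1) * h `^ (alpha - 1) by rewrite /zp powRM // ltW.
pose W k := omega _ alpha k * expR ((1 - k%:R) * z).
have -> : \sum_(1 <= i < M) v i * spatial_op alpha lambda h M v i
  = (h `^ alpha)^-1 * ((W 1%N + 2 / 3 * (alpha - 1) * z * zp) * T 0 + kappa _ alpha z * T 1
      + W 3%N * T 2 + \sum_(k < M) W k.+4 * T k.+3).
  have -> : \sum_(1 <= i < M) v i * spatial_op alpha lambda h M v i =
    (h `^ alpha)^-1 * (\sum_(1 <= i < M) v i *
        (\sum_(0 <= k < (M - i + 1).+1) w alpha lambda h k * v (i + k - 1)%N))
    - alpha * lambda `^ (alpha - 1) / (2 * h) *
      (\sum_(1 <= i < M) E * (v i * v i.-1) - \sum_(1 <= i < M) y * (v i * v i.+1))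
    + lambda `^ alpha * (alpha - 1) * \sum_(1 <= i < M) v i * compactB lambda h v i.
    rewrite -sumrB !mulr_sumr -sumrB -big_split /=; apply: eq_bigr => i _.
    by rewrite /spatial_op -/z -/E -/y div1r; ring.
  have wW k : w alpha lambda h k = W k by exact: w_omega.
  rewrite compactB_form convolution_form wW.
  under [\sum_(k < M.+3) _]eq_bigr do rewrite wW.
  rewrite (sum_interior _ _ (fun i => E * _)) ?v0 ?mul0r ?mulr0 //.
  rewrite (sum_interior _ _ (fun i => y * _)) ?v0 ?mul0r ?mulr0 //.
  rewrite -!mulr_sumr corr_pred //.
  have -> : \sum_(i < M) v i * v i.+1 = T 1 by apply: eq_bigr => i _; rewrite addn1.
  rewrite -[corr _ _ _ _]/(T 1) !big_ord_recl /=.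
  rewrite /bump /= /kappa -/E -/y -/zp -lE zpE -hE.
  have -> : W 0%N = omega _ alpha 0 * E by rewrite /W subr0 mul1r.
  have -> : W 2%N = omega _ alpha 2 * y by rewrite /W; congr (_ * expR _); ring.
  rewrite /z; field.
  by rewrite !gt_eqF.
apply: mulr_ge0_le0; first by rewrite invr_ge0 ltW.
apply: (weighted_corr_le _ _ _ v0 vM _ _ _ (fun k => W k.+4)).
- exact: kappa_ge0.
- have -> : W 3%N = omega _ alpha 3 * y ^+ 2.
    by rewrite /W -expRM_natl; congr (_ * expR _); ring.
  exact: kappa_omega3_ge0.
- by move=> k; rewrite mulr_ge0 ?expR_ge0 ?omega_ge0.
have := total_weight_le0 _ _ _ halpha z01 M.
rewrite !big_ord_recl -/E -/y -/zp /= /bump /= -/(W 0%N) -/(W 1%N) -/(W 2%N) -/(W 3%N).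
rewrite /kappa -/E -/y -/zp.
have -> : W 0%N = omega _ alpha 0 * E by rewrite /W subr0 mul1r.
have -> : W 2%N = omega _ alpha 2 * y by rewrite /W; congr (_ * expR _); ring.
rewrite /W; lra.
Qed.

End SpatialForm.

(** * Energy estimates for the compact operator *)

Lemma sum_mul_pred (R : realFieldType) (M : nat) (s t : nat -> R) :
  s 0 = 0 -> s M = 0 -> \sum_(i < M) s i * t i.-1 = \sum_(i < M) t i * s i.+1.
Proof.
case: M => [|m] s0 sM; first by rewrite !big_ord0.
rewrite big_ord_recl [RHS]big_ord_recr /= s0 mul0r add0r sM mulr0 addr0.
by apply: eq_bigr => i _; rewrite /bump /= add1n mulrC.
Qed.

Lemma sum_sqr_pred_le (R : realFieldType) (M : nat) (u : nat -> R) :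
  u 0 = 0 -> \sum_(i < M) u i.-1 ^+ 2 <= corr _ M u 0.
Proof.
rewrite corr0E; case: M => [|m] u0; first by rewrite !big_ord0.
rewrite big_ord_recl [leRHS]big_ord_recr /= u0 expr0n add0r.
by rewrite lerDl sqr_ge0.
Qed.

Section EnergyEstimates.
Variables (R : realType) (M : nat) (u v : nat -> R).
Hypotheses (M_gt0 : (0 < M)%N) (u0 : u 0 = 0) (v0 : v 0 = 0).
Hypotheses (uM : forall i, (M <= i)%N -> u i = 0) (vM : forall i, (M <= i)%N -> v i = 0).

(** Here cosh z <= 5/3 on [0, 1] and T_1 >= -T_0, and 1/9 = 2/3 - 5/9. *)
Lemma compactB_coercive (lambda h : R) : 0 <= lambda * h <= 1 ->
  1 / 9 * corr _ M v 0 <= \sum_(1 <= i < M) v i * compactB lambda h v i.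
Proof.
move=> z01; rewrite compactB_form //.
have := expR_le_taylor4 _ _ z01; have := expRN_le_taylor2 _ _ z01.
have := expR_gt0 (lambda * h); have := expR_gt0 (- (lambda * h)).
have T0 := corr0_ge0 _ M v; have T1 := corr_geN _ M v vM 1.
have /andP[z0 z1] := z01.
have zk k : (lambda * h) ^+ k <= 1 by rewrite exprn_ile1.
have z2z : (lambda * h) ^+ 2 <= lambda * h by rewrite expr2 ler_piMl.
move: (zk 2%N) (zk 3%N) (zk 4%N) (zk 5%N) => ? ? ? ? E0 y0 y1 E1.
have C1 : (expR (lambda * h) + expR (- (lambda * h))) / 2 <= 5 / 3 by lra.
have C0 : 0 <= (expR (lambda * h) + expR (- (lambda * h))) / 2 by lra.
move: (_ / 2) C0 C1 => C C0 C1; nra.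
Qed.

(** Young's inequality p q <= 6 q^2 + p^2 / 24, with total stencil weight at most 4/3. The resulting
    1/18 is half of the coercivity constant, so that this term can be absorbed. *)
Lemma compactB_cross_le (lambda h : R) : 0 <= lambda * h <= 1 ->
  \sum_(1 <= i < M) v i * compactB lambda h u i <= 8 * corr _ M u 0 + 1 / 18 * corr _ M v 0.
Proof.
move=> z01; rewrite sum_interior ?v0 ?mul0r //.
set E := expR (lambda * h); set y := expR (- (lambda * h)).
have E0 : 0 <= E by exact: expR_ge0.
have y0 : 0 <= y by exact: expR_ge0.
have EyC : E / 6 + 2 / 3 + y / 6 <= 4 / 3.
  have /andP[z0 z1] := z01.
  have zk k : (lambda * h) ^+ k <= 1 by rewrite exprn_ile1.
  have z2z : (lambda * h) ^+ 2 <= lambda * h by rewrite expr2 ler_piMl.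
  have := expR_le_taylor4 _ _ z01; have := expRN_le_taylor2 _ _ z01.
  rewrite -/E -/y; move: (zk 2%N) (zk 3%N) (zk 4%N) (zk 5%N); lra.
have young (p q : R) : p * q <= 6 * q ^+ 2 + p ^+ 2 / 24.
  by have := sqr_ge0 (p - 12 * q); lra.
apply: (@le_trans _ _ (\sum_(i < M) (E / 6 * (6 * u i.-1 ^+ 2 + v i ^+ 2 / 24)
   + 2 / 3 * (6 * u i ^+ 2 + v i ^+ 2 / 24) + y / 6 * (6 * u (i + 1)%N ^+ 2 + v i ^+ 2 / 24)))).
  apply: ler_sum => i _; rewrite /compactB -/E -/y addn1.
  have e6 : 0 <= E / 6 by rewrite divr_ge0.
  have y6 : 0 <= y / 6 by rewrite divr_ge0.
  have := ler_wpM2l e6 (young (v i) (u i.-1)).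
  have := ler_wpM2l y6 (young (v i) (u i.+1)).
  have := young (v i) (u i); lra.
have pr := sum_sqr_pred_le _ M _ u0.
have nx : \sum_(i < M) u (i + 1)%N ^+ 2 = corr _ M u 0.
  rewrite (sum_shift _ _ (fun i => u i ^+ 2)); last by move=> i /uM ->; rewrite expr0n.
  by rewrite big_ord_recr big_ord0 /= u0 expr0n /= addr0 subr0 corr0E.
rewrite !big_split /= -!mulr_sumr !big_split /= -!mulr_sumr -!mulr_suml nx -!corr0E.
have T0 := corr0_ge0 _ M u; have T0' := corr0_ge0 _ M v.
move: (corr _ M u 0) (corr _ M v 0) (\sum_(i < M) _) T0 T0' pr => a c b a0 c0 ba.
have h1 : 0 <= E * (a - b) by rewrite mulr_ge0 // subr_ge0.
have h2 : 0 <= (4 / 3 - (E / 6 + 2 / 3 + y / 6)) * (6 * a + c / 24).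
  by apply: mulr_ge0; lra.
lra.
Qed.

(** At lambda = h = 0 the operator is symmetric, and this form is equivalent to the squared norm
    with constants 1/3 and 1. *)
Definition energy (t : nat -> R) : R := \sum_(1 <= i < M) t i * compactB 0 0 t i.

Lemma energyE : energy v = 2 / 3 * corr _ M v 0 + 1 / 3 * corr _ M v 1.
Proof.
by rewrite /energy compactB_form // mul0r oppr0 expR0; field.
Qed.

Lemma energy_le : energy v <= corr _ M v 0.
Proof. by rewrite energyE; have := corr_le _ M v vM 1; lra. Qed.

Lemma energy_ge : corr _ M v 0 <= 3 * energy v.
Proof. by rewrite energyE; have := corr_geN _ M v vM 1; lra. Qed.

End EnergyEstimates.

(** The energy of u - v is nonnegative, and the two cross terms agree by symmetry. *)
Lemma energy_cross_le (R : realType) (M : nat) (u v : nat -> R) : (0 < M)%N ->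
  u 0 = 0 -> v 0 = 0 ->
  (forall i, (M <= i)%N -> u i = 0) -> (forall i, (M <= i)%N -> v i = 0) ->
  2 * \sum_(1 <= i < M) v i * compactB 0 0 u i <= energy _ M u + energy _ M v.
Proof.
move=> M0 u0 v0 uM vM.
pose d i := u i - v i.
have d0 : d 0 = 0 by rewrite /d u0 v0 subrr.
have dM i : (M <= i)%N -> d i = 0 by move=> iM; rewrite /d uM // vM // subrr.
have : 0 <= energy _ M d.
  by have := energy_ge _ _ _ M0 d0 dM; have := corr0_ge0 _ M d; lra.
have sym : \sum_(1 <= i < M) u i * compactB 0 0 v i = \sum_(1 <= i < M) v i * compactB 0 0 u i.
  have form (s t : nat -> R) : s 0 = 0 -> \sum_(1 <= i < M) s i * compactB 0 0 t i
     = 1 / 6 * \sum_(i < M) s i * t i.-1 + 2 / 3 * \sum_(i < M) s i * t i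
       + 1 / 6 * \sum_(i < M) s i * t i.+1.
    move=> s0; rewrite sum_interior ?s0 ?mul0r // !mulr_sumr -!big_split /=.
    by apply: eq_bigr => i _; rewrite /compactB mul0r oppr0 expR0; ring.
  rewrite !form // (sum_mul_pred _ _ u v u0 (uM _ (leqnn M)))
    (sum_mul_pred _ _ v u v0 (vM _ (leqnn M))).
  have -> : \sum_(i < M) u i * v i = \sum_(i < M) v i * u i by apply: eq_bigr => i _; exact: mulrC.
  by ring.
have -> : energy _ M d = energy _ M u + energy _ M v
    - \sum_(1 <= i < M) u i * compactB 0 0 v i - \sum_(1 <= i < M) v i * compactB 0 0 u i.
  rewrite /energy -big_split -!sumrB /=; apply: eq_bigr => i _.
  by rewrite /d /compactB; ring.
rewrite sym; lra.
Qed.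

(** * Conjugation by the exponential tilt *)

Section Conjugation.
Variables (R : realType) (alpha lambda h : R) (M : nat) (e v : nat -> R).
Hypothesis halpha : 1 < alpha < 2.
Hypothesis ev : forall i, e i = expR (i%:R * (lambda * h)) * v i.

Lemma compactB_conj i : (0 < i)%N ->
  compactB lambda h e i = expR (i%:R * (lambda * h)) * compactB 0 0 v i.
Proof.
case: i => // i _; rewrite /compactB !ev /= mul0r oppr0 expR0.
set z := lambda * h.
have e1 : expR (i.+1%:R * z) = expR z * expR (i%:R * z).
  by rewrite -expRD; congr expR; rewrite -natr1; ring.
have e2 : expR (i.+1%:R * z) = expR (- z) * expR (i.+2%:R * z).
  by rewrite -expRD; congr expR; rewrite -!natr1; ring.
rewrite !mulrDr; congr (_ + _ + _); first by rewrite e1; ring.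
  by ring.
by rewrite e2; ring.
Qed.

(** The tilt cancels the factor e^((1 - k) lambda h) of each weight. The operator with lambda = 0
    has no lower-order terms, because 0 to the nonzero powers alpha and alpha - 1 is 0. *)
Lemma spatial_op_conj i : (0 < i)%N ->
  spatial_op alpha lambda h M e i = expR (i%:R * (lambda * h)) *
    (spatial_op alpha 0 h M v i - alpha * lambda `^ (alpha - 1) / (2 * h) * (v i.-1 - v i.+1)
     + lambda `^ alpha * (alpha - 1) * compactB 0 0 v i).
Proof.
move=> i0; have /andP[a1 a2] := halpha.
have al0 : alpha != 0 by rewrite gt_eqF //; lra.
have ax0 : alpha - 1 != 0 by rewrite gt_eqF // subr_gt0.
set z := lambda * h; set X := expR (i%:R * z).
have conv : \sum_(0 <= k < (M - i + 1).+1) w alpha lambda h k * e (i + k - 1)%N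
    = X * \sum_(0 <= k < (M - i + 1).+1) w alpha 0 h k * v (i + k - 1)%N.
  rewrite mulr_sumr; apply: eq_bigr => k _.
  rewrite !w_omega ev !mul0r mulr0 expR0 mulr1 -/z.
  have -> : X = expR ((1 - k%:R) * z) * expR ((i + k - 1)%:R * z).
    by rewrite -expRD; congr expR; rewrite natrB ?natrD; [ring|lia].
  by ring.
have skew : expR z * e i.-1 - expR (- z) * e i.+1 = X * (v i.-1 - v i.+1).
  rewrite /X; case: i i0 {X conv} => // i _; rewrite !ev /= -/z.
  have e1 : expR (i.+1%:R * z) = expR z * expR (i%:R * z).
    by rewrite -expRD; congr expR; rewrite -natr1; ring.
  have e2 : expR (i.+1%:R * z) = expR (- z) * expR (i.+2%:R * z).
    by rewrite -expRD; congr expR; rewrite -!natr1; ring.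
  by rewrite mulrBr {1}e1 e2; ring.
rewrite /spatial_op compactB_conj // conv -/z skew -/X !powR0 //; ring.
Qed.

End Conjugation.

(** * Growth of the error over one and several time steps *)

Section HomogeneousScheme.
Variables (R : realType) (alpha lambda K h tau : R) (M N : nat) (e : nat -> nat -> R).
Hypotheses (halpha : 1 < alpha < 2) (hlambda : 0 <= lambda) (hK : 0 <= K).
Hypotheses (h_gt0 : 0 < h) (tau_gt0 : 0 < tau) (M_gt0 : (0 < M)%N).
Hypothesis z_le1 : lambda * h <= 1.
Hypothesis e0 : forall n, e n 0 = 0.
Hypothesis eM : forall n i, (M <= i)%N -> e n i = 0.
Hypothesis step : forall n i, (n < N)%N -> (1 <= i < M)%N ->
  compactB lambda h (e n.+1) i - K * tau * spatial_op alpha lambda h M (e n.+1) i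
  = compactB lambda h (e n) i.

Let z01 : 0 <= lambda * h <= 1.
Proof. by rewrite z_le1 andbT mulr_ge0 // ltW. Qed.

Let Ktau_ge0 : 0 <= K * tau. Proof. by rewrite mulr_ge0 // ltW. Qed.

Let T n := corr _ M (e n) 0.

Let T_ge0 n : 0 <= T n. Proof. exact: corr0_ge0. Qed.

(** Testing the scheme with the new error gives T_(n+1) / 9 <= 8 T_n + T_(n+1) / 18, whence 144 = 8
    * 18. *)
Lemma corr0_step_le n : (n < N)%N -> T n.+1 <= 144 * T n.
Proof.
move=> nN.
have coer := compactB_coercive _ _ _ M_gt0 (e0 n.+1) (eM n.+1) _ _ z01.
have cross := compactB_cross_le _ _ _ _ M_gt0 (e0 n) (e0 n.+1) (eM n) _ _ z01.
have diss := spatial_op_le0_padded _ _ _ _ _ _ halpha hlambda h_gt0 M_gt0 (e0 n.+1) (eM n.+1) z_le1.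
have eqn : \sum_(1 <= i < M) e n.+1 i * compactB lambda h (e n) i
  = \sum_(1 <= i < M) e n.+1 i * compactB lambda h (e n.+1) i
    - K * tau * \sum_(1 <= i < M) e n.+1 i * spatial_op alpha lambda h M (e n.+1) i.
  rewrite mulr_sumr -sumrB; apply: eq_big_nat => i iM.
  by rewrite -(step _ _ nN iM); ring.
have := mulr_ge0_le0 Ktau_ge0 diss.
move: eqn coer cross; rewrite -/(T n) -/(T n.+1); lra.
Qed.

Lemma corr0_le_expn n : (n <= N)%N -> T n <= 144 ^+ n * T 0.
Proof.
elim: n => [|n IH] nN; first by rewrite expr0 mul1r.
rewrite exprS -mulrA; apply: le_trans (corr0_step_le _ nN) _.
by rewrite ler_pM2l // IH // ltnW.
Qed.

(* The exponential tilt symmetrizes the compact operator; only the zeroth-order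
   term of the spatial operator then fails to be dissipative. *)
Let v n i := expR (- (i%:R * (lambda * h))) * e n i.

Let ev n i : e n i = expR (i%:R * (lambda * h)) * v n i.
Proof. by rewrite /v mulrA -expRD subrr expR0 mul1r. Qed.

Let v0 n : v n 0 = 0. Proof. by rewrite /v e0 mulr0. Qed.

Let vM n i : (M <= i)%N -> v n i = 0. Proof. by move=> iM; rewrite /v eM // mulr0. Qed.

Let c : R := K * (lambda `^ alpha * (alpha - 1)).

Let c_ge0 : 0 <= c.
Proof.
by have /andP[a1 a2] := halpha; rewrite mulr_ge0 // mulr_ge0 ?powR_ge0 // subr_ge0 ltW.
Qed.

(** Tested with the new tilted error, the skew term vanishes and the dissipative one is dropped,
    leaving (1 - 2 c tau) times the new energy at most the old. For 4 c tau <= 1, (1 + 4 c tau) (1 -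
    2 c tau) >= 1. *)
Lemma energy_step_le n : 4 * c * tau <= 1 -> (n < N)%N ->
  energy _ M (v n.+1) <= expR (4 * c * tau) * energy _ M (v n).
Proof.
move=> ct nN; have /andP[a1 a2] := halpha.
have zz : 0 * h <= 1 by rewrite mul0r.
have diss := spatial_op_le0_padded _ _ _ _ _ _ halpha (lexx 0) h_gt0 M_gt0 (v0 n.+1) (vM n.+1) zz.
have cross := energy_cross_le _ _ _ _ M_gt0 (v0 n) (v0 n.+1) (vM n) (vM n.+1).
have skew : \sum_(1 <= i < M) v n.+1 i * (v n.+1 i.-1 - v n.+1 i.+1) = 0.
  rewrite sum_interior ?v0 ?mul0r //; under eq_bigr do rewrite mulrBr.
  by rewrite sumrB (sum_mul_pred _ _ _ _ (v0 _) (vM _ _ (leqnn M))) subrr.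
have eqn : \sum_(1 <= i < M) v n.+1 i * compactB 0 0 (v n) i
  = (1 - c * tau) * energy _ M (v n.+1)
    - K * tau * \sum_(1 <= i < M) v n.+1 i * spatial_op alpha 0 h M (v n.+1) i
    + K * tau * (alpha * lambda `^ (alpha - 1) / (2 * h))
      * \sum_(1 <= i < M) v n.+1 i * (v n.+1 i.-1 - v n.+1 i.+1).
  rewrite /energy !mulr_sumr -sumrB -big_split /=; apply: eq_big_nat => i iM.
  have i0 : (0 < i)%N by case/andP: iM.
  have := step _ _ nN iM.
  rewrite (compactB_conj _ _ _ _ _ (ev n) _ i0) (compactB_conj _ _ _ _ _ (ev n.+1) _ i0).
  rewrite (spatial_op_conj _ _ _ _ _ _ _ halpha (ev n.+1) _ i0).
  have X0 : expR (i%:R * (lambda * h)) != 0 by rewrite gt_eqF // expR_gt0.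
  rewrite (mulrCA (K * tau)) -mulrBr => /(mulfI X0) <-.
  by rewrite /c; ring.
rewrite skew mulr0 addr0 in eqn.
have E0 : 0 <= energy _ M (v n).
  by have := energy_ge _ _ _ M_gt0 (v0 n) (vM n); have := corr0_ge0 _ M (v n); lra.
have E1 : 0 <= energy _ M (v n.+1).
  by have := energy_ge _ _ _ M_gt0 (v0 n.+1) (vM n.+1); have := corr0_ge0 _ M (v n.+1); lra.
have dd := mulr_ge0_le0 Ktau_ge0 diss.
have main : (1 - 2 * (c * tau)) * energy _ M (v n.+1) <= energy _ M (v n).
  by move: eqn cross dd; lra.
have s0 : 0 <= c * tau by rewrite mulr_ge0 // ltW.
apply: (@le_trans _ _ ((1 + 4 * c * tau) * energy _ M (v n))); last first.
  by rewrite ler_wpM2r // expR_ge1Dx.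
have s1 : 0 <= 1 + 4 * c * tau by rewrite addr_ge0 // -mulrA mulr_ge0.
apply: le_trans (ler_wpM2l s1 main).
have : 0 <= (2 * (c * tau) - 8 * (c * tau) * (c * tau)) * energy _ M (v n.+1).
  by rewrite mulr_ge0 //; nra.
lra.
Qed.

Lemma energy_le_expR n : 4 * c * tau <= 1 -> (n <= N)%N ->
  energy _ M (v n) <= expR (4 * c * tau * n%:R) * energy _ M (v 0).
Proof.
move=> ct; elim: n => [|n IH] nN; first by rewrite mulr0 expR0 mul1r.
apply: le_trans (energy_step_le _ ct nN) _.
have -> : n.+1%:R = n%:R + 1 :> R by rewrite natr1.
rewrite mulrDr mulr1 addrC expRD -[leRHS]mulrA ler_pM2l ?expR_gt0 //.
by rewrite IH // ltnW.
Qed.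

(** The tilt and the norm equivalence are used only at times 0 and n, so the factors 3 and e^(2
    lambda M h) do not accumulate over the steps. *)
Lemma corr0_le_expR n : 4 * c * tau <= 1 -> (n <= N)%N ->
  T n <= 3 * expR (2 * (lambda * (M%:R * h)) + 4 * c * (N%:R * tau)) * T 0.
Proof.
move=> ct nN.
have z0 : 0 <= lambda * h by case/andP: z01.
have w1 : T n <= expR (2 * (lambda * (M%:R * h))) * corr _ M (v n) 0.
  rewrite /T !corr0E mulr_sumr; apply: ler_sum => i _.
  rewrite ev exprMn -expRM_natl ler_wpM2r ?sqr_ge0 // ler_expR.
  have : i%:R <= M%:R :> R by rewrite ler_nat ltnW.
  by move=> /(ler_wpM2r z0); lra.
have w2 : corr _ M (v 0) 0 <= T 0.
  rewrite /T !corr0E; apply: ler_sum => i _.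
  rewrite /v exprMn ler_piMl ?sqr_ge0 // exprn_ile1 ?expR_ge0 // expR_le1 oppr_le0.
  by rewrite mulr_ge0.
have w3 := energy_ge _ _ _ M_gt0 (v0 n) (vM n).
have w4 := energy_le _ _ _ M_gt0 (v0 0) (vM 0).
have w5 := energy_le_expR _ ct nN.
have w6 : expR (4 * c * tau * n%:R) <= expR (4 * c * (N%:R * tau)).
  have c4 : 0 <= 4 * c * tau by apply: mulr_ge0; [exact: mulr_ge0|exact: ltW].
  have nN' : n%:R <= N%:R :> R by rewrite ler_nat.
  by rewrite ler_expR; have := ler_wpM2l c4 nN'; lra.
have E0 : 0 <= energy _ M (v 0).
  by have := energy_ge _ _ _ M_gt0 (v0 0) (vM 0); have := corr0_ge0 _ M (v 0); lra.
have w7 := le_trans w5 (ler_pM (expR_ge0 _) E0 w6 (le_trans w4 w2)).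
have X0 := expR_ge0 (2 * (lambda * (M%:R * h))).
apply: (le_trans w1); apply: (le_trans (ler_wpM2l X0 w3)).
by have := ler_wpM2l X0 w7; rewrite expRD; lra.
Qed.

End HomogeneousScheme.

(** * Extension by zero and stability *)

Lemma eq_compactB (R : realType) (lambda h : R) (M : nat) (u v : nat -> R) i :
  (forall j, (j <= M)%N -> u j = v j) -> (i < M)%N -> compactB lambda h u i = compactB lambda h v i.
Proof. by move=> uv iM; rewrite /compactB !uv //; lia. Qed.

Lemma eq_spatial_op (R : realType) (alpha lambda h : R) (M : nat) (u v : nat -> R) i :
  (forall j, (j <= M)%N -> u j = v j) -> (0 < i < M)%N ->
  spatial_op alpha lambda h M u i = spatial_op alpha lambda h M v i.
Proof.
move=> uv /andP[i0 iM]; rewrite /spatial_op (eq_compactB _ _ _ _ _ _ _ uv iM).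
rewrite (uv i.-1) ?(uv i.+1) //; last by lia.
by congr (_ * _ - _ + _); apply: eq_big_nat => k kM; rewrite uv //; lia.
Qed.

Theorem theorem3p4 (R : realType) (alpha lambda K a b T : R)
    (halpha : 1 < alpha < 2) (hlambda : 0 <= lambda) (hK : 0 <= K)
    (hab : a < b) (hT : 0 < T) :
  stable alpha lambda K a b T
    (fun h : R => 0 < h /\ (0 < lambda -> h <= 1 / lambda)).
Proof.
have /andP[a1 a2] := halpha.
set c := K * (lambda `^ alpha * (alpha - 1)).
have c0 : 0 <= c by rewrite mulr_ge0 // mulr_ge0 ?powR_ge0 // subr_ge0 ltW.
set C1 := 3 * expR (2 * (lambda * (b - a)) + 4 * c * T).
(* If 4 c tau > 1 then N < 4 c T, so this exponent bounds the number of steps. *)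
set C2 := 144 ^+ Num.truncn (4 * c * T) : R.
have C1_ge0 : 0 <= C1 by rewrite mulr_ge0 ?expR_ge0.
have C2_ge0 : 0 <= C2 by rewrite exprn_ge0.
exists (Num.sqrt (C1 + C2)) => M N M0 N0 h [h0 hz] f u_a u0 u0' U U'.
move=> [_ left right scheme] [_ left' right' scheme'] eps n nN.
have M0' : 0 < M%:R :> R by rewrite ltr0n.
have N0' : 0 < N%:R :> R by rewrite ltr0n.
pose tau := T / N%:R.
have tau0 : 0 < tau by rewrite divr_gt0.
have Mh : M%:R * h = b - a by rewrite mulrC divfK // gt_eqF.
have Ntau : N%:R * tau = T by rewrite mulrC divfK // gt_eqF.
have z1 : lambda * h <= 1.
  have [l0|l0] := ltP 0 lambda; last by rewrite (le_anti (introT andP (conj l0 hlambda))) mul0r.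
  by rewrite -ler_pdivlMl // mulrC hz.
(* The scheme controls [eps] only at nodes up to M and times up to N; cutting it off outside the
   interior gives the zero extension that the estimates require. *)
pose e m i := if (0 < i < M)%N then eps m i else 0.
have e0 m : e m 0 = 0 by [].
have eM m i : (M <= i)%N -> e m i = 0.
  by move=> iM; rewrite /e [(i < M)%N]ltnNge iM andbF.
have e_eps m : (m <= N)%N -> forall j, (j <= M)%N -> e m j = eps m j.
  move=> mN j jM; rewrite /e; case: ifPn => //; rewrite negb_and -eqn0Ngt -leqNgt.
  case/orP => [/eqP ->|Mj]; first by rewrite /eps left // left' // subrr.
  have -> : j = M by apply/eqP; rewrite eqn_leq jM.
  by rewrite /eps right // right' // subrr.
have step m i : (m < N)%N -> (1 <= i < M)%N ->
    compactB lambda h (e m.+1) i - K * tau * spatial_op alpha lambda h M (e m.+1) i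
    = compactB lambda h (e m) i.
  move=> mN iM; have /andP[i1 iM'] := iM.
  rewrite !(eq_compactB _ _ _ _ _ _ _ (e_eps _ _) iM') ?(ltnW mN) //.
  rewrite (eq_spatial_op _ _ _ _ _ _ _ _ (e_eps _ mN) iM).
  have mN' : (m <= N - 1)%N by rewrite subn1 -ltnS prednK.
  have iM1 : (1 <= i <= M - 1)%N by rewrite i1 subn1 -ltnS prednK.
  have := scheme _ _ mN' iM1; have := scheme' _ _ mN' iM1.
  rewrite -/h -/tau.
  have -> : compactB lambda h (eps m) i = compactB lambda h (U' m) i - compactB lambda h (U m) i.
    by rewrite /compactB /eps; ring.
  have -> : compactB lambda h (eps m.+1) i
      = compactB lambda h (U' m.+1) i - compactB lambda h (U m.+1) i.
    by rewrite /compactB /eps; ring.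
  have -> : spatial_op alpha lambda h M (eps m.+1) i
      = spatial_op alpha lambda h M (U' m.+1) i - spatial_op alpha lambda h M (U m.+1) i.
    rewrite /spatial_op.
    have -> : \sum_(0 <= k < (M - i + 1).+1) w alpha lambda h k * eps m.+1 (i + k - 1)%N
      = \sum_(0 <= k < (M - i + 1).+1) w alpha lambda h k * U' m.+1 (i + k - 1)%N
        - \sum_(0 <= k < (M - i + 1).+1) w alpha lambda h k * U m.+1 (i + k - 1)%N.
      by rewrite -sumrB; apply: eq_bigr => k _; rewrite -mulrBr.
    by rewrite /compactB /eps; ring.
  lra.
have normE m : (m <= N)%N -> grid_norm h M (eps m) = Num.sqrt (h * corr _ M (e m) 0).
  move=> mN; congr (Num.sqrt (h * _)); rewrite corr0E -(sum_interior _ _ (fun i => e m i ^+ 2)) //.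
    by apply: eq_big_nat => i /andP[_ iM]; rewrite e_eps // ltnW.
  by rewrite e0 expr0n.
rewrite !normE // -sqrtrM ?addr_ge0 //; apply: ler_wsqrtr.
have T0 : 0 <= corr _ M (e 0) 0 := corr0_ge0 _ _ _.
suff : corr _ M (e n) 0 <= (C1 + C2) * corr _ M (e 0) 0.
  by move=> /(ler_wpM2l (ltW h0)); rewrite mulrCA.
have [small|large] := leP (4 * c * tau) 1.
  have := corr0_le_expR _ _ _ _ _ _ _ _ _ halpha hlambda hK h0 tau0 M0 z1 e0 eM step _ small nN.
  rewrite Mh Ntau -/C1 => /le_trans; apply.
  by rewrite ler_wpM2r // lerDl.
apply: le_trans (corr0_le_expn _ _ _ _ _ _ _ _ _ halpha hlambda hK h0 tau0 M0 z1 e0 eM step _ nN) _.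
apply: ler_wpM2r => //; apply: ler_wpDl => //.
apply: ler_weXn2l; first by rewrite ler1n.
apply: (leq_trans nN); rewrite truncn_ge_nat; last by apply: mulr_ge0; [exact: mulr_ge0|exact: ltW].
by move: large; rewrite /tau mulrA ltr_pdivlMr // mul1r => /ltW.
Qed.
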